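(* Let $\Gamma=(V,E)$ be a multigraph with no isolated vertex and let $\beta$ be a co-action of a compact quantum group $(\mathcal{A},\Delta)$ on $(V,E)$ preserving its quantum symmetry in Banica's sense. Let $(u^\sigma_\tau)_{\sigma,\tau\in E}$ and $(q^k_i)_{k,i\in V}$ be the co-representation matrices of $\beta$ and of its induced co-action $\alpha$ on $C(V)$. Then $\beta$ induces a co-action $\beta':C^*(\Gamma)\to C^*(\Gamma)\otimes\mathcal{A}$ of $(\mathcal{A},\Delta)$ on the graph C*-algebra $C^*(\Gamma)$ satisfying $$\beta'(p_i)=\sum_{k\in V}p_k\otimes q^k_i\quad(i\in V),\qquad \beta'(s_\tau)=\sum_{\sigma\in E}s_\sigma\otimes u^\sigma_\tau\quad(\tau\in E).$$
   Context: **Multigraphs.** A multigraph $(V,E)$ consists of finite sets $V$, $E$ with source and target maps $s,t:E\to V$. No isolated vertex: every vertex is the source or target of some edge. $E^i=\{\tau:s(\tau)=i\}$, $E_j=\{\tau:t(\tau)=j\}$, $V^s=s(E)$, $V^t=t(E)$. **Graph C*-algebra.** $C^*(\Gamma)$ is the universal C*-algebra generated by partial isometries $\{s_\tau:\tau\in E\}$ and mutually orthogonal projections $\{p_i:i\in V\}$ with $s_\tau^*s_\tau=p_{t(\tau)}$ for all $\tau\in E$ and $\sum_{\tau\in E^i}s_\tau s_\tau^*=p_i$ for all $i\in V^s$. **Function spaces.** For a finite set $X$, $C(X)$ is the algebra of functions on $X$ with basis the characteristic functions $\chi_x$; $L^2(X)$ is the same space as a Hilbert space with orthonormal basis $(\chi_x)$.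 $L^2(E)$ is a $C(V)$-$C(V)$ bimodule by $\chi_i.\chi_\tau=\delta_{i,s(\tau)}\chi_\tau$, $\chi_\tau.\chi_j=\delta_{t(\tau),j}\chi_\tau$, extended by $(f\otimes a)(\xi\otimes b)=f.\xi\otimes ab$, $(\xi\otimes b)(f\otimes a)=\xi.f\otimes ba$. $p_\tau\in B(L^2(E))$ here denotes the projection onto $\mathbb{C}\chi_\tau$; $S(\chi_v)=\sum_{\tau\in E^v}p_\tau$ ($v\in V^s$), $T(\chi_w)=\sum_{\tau\in E_w}p_\tau$ ($w\in V^t$) define algebra maps $S:C(V^s)\to B(L^2(E))$, $T:C(V^t)\to B(L^2(E))$. **Compact quantum groups** are in Woronowicz's sense; tensor products are minimal. A co-representation on $L^2(E)$ is a linear $\beta:L^2(E)\to L^2(E)\otimes\mathcal{A}$, $\beta(\chi_\tau)=\sum_\sigma\chi_\sigma\otimes u^\sigma_\tau$, with $\Delta(u^\sigma_\tau)=\sum_\kappa u^\sigma_\kappa\otimes u^\kappa_\tau$; $U=(u^\sigma_\tau)$ is its co-representation matrix; the contragradient $\overline\beta$ has matrix $(u^{\sigma*}_\tau)$; $\beta$ is bi-unitary if $U$ and $\overline U=(u^{\sigma*}_\tau)$ are both unitary. $Ad_\beta(X)=U(X\otimes1)U^*$ for $X\in B(L^2(E))$. A co-action of $(\mathcal{A},\Delta)$ on a unital C*-algebra $\mathcal{B}$ is a unital $*$-homomorphism $\alpha:\mathcal{B}\to\mathcal{B}\otimes\mathcal{A}$ with $(\alpha\otimes id)\alpha=(id\otimes\Delta)\alpha$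 and $\mathrm{span}\,\alpha(\mathcal{B})(1\otimes\mathcal{A})$ norm-dense in $\mathcal{B}\otimes\mathcal{A}$; for $\mathcal{B}=C(V)$ its co-representation matrix is $(q^k_i)$ with $\alpha(\chi_i)=\sum_k\chi_k\otimes q^k_i$. **Banica's sense.** A bi-unitary co-representation $\beta$ on $L^2(E)$ is a co-action on $(V,E)$ preserving its quantum symmetry in Banica's sense if: (1) $Ad_\beta(S(C(V^s)))\subseteq S(C(V^s))\otimes\mathcal{A}$; (2) $Ad_{\overline\beta}(T(C(V^t)))\subseteq T(C(V^t))\otimes\mathcal{A}$; (3) the induced co-actions $\alpha_s$ on $C(V^s)$, $\alpha_t$ on $C(V^t)$ (the unique co-actions with $\alpha_s(\chi_i)\beta(\chi_\tau)=\beta(\chi_i.\chi_\tau)$, $\beta(\chi_\tau)\alpha_t(\chi_j)=\beta(\chi_\tau.\chi_j)$ for $i\in V^s,j\in V^t,\tau\in E$; they exist under (1),(2)) preserve and agree on $C(V^s\cap V^t)$; (4) $\beta(\xi_0)=\xi_0\otimes1$, $\xi_0=\sum_{\tau\in E}\chi_\tau$. The induced co-action $\alpha$ on $C(V)$ is given by $\alpha(\chi_k)=\alpha_s(\chi_k)$ for $k\in V^s$ and $\alpha(\chi_k)=\alpha_t(\chi_k)$ for $k\in V^t$. *)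

(* Defs.v *)
From HB Require Import structures.
From mathcomp Require Import all_boot all_order all_algebra.
From mathcomp Require Import all_classical all_reals all_analysis.
From mathcomp Require Import complex.

Set Implicit Arguments.
Unset Strict Implicit.
Unset Printing Implicit Defensive.

Import Order.TTheory GRing.Theory Num.Theory.
Import numFieldNormedType.Exports.

Local Open Scope classical_set_scope.
Local Open Scope ring_scope.
Local Open Scope complex_scope.

(* Abstract complex C*-algebras, not assumed unital.  As everywhere in
   MathComp-Analysis, the norm of a normed module over R[i] takes its values
   in R[i] (they are nonnegative, hence real). *)
HB.mixin Record CompleteNormedModule_isCstar (R : realType) A
    of CompleteNormedModule R[i] A := {
  cmul : A -> A -> A;
  star : A -> A;
  cmulA : forall x y z, cmul x (cmul y z) = cmul (cmul x y) z;
  cmulDl : forall x y z, cmul (x + y) z = cmul x z + cmul y z;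
  cmulDr : forall x y z, cmul x (y + z) = cmul x y + cmul x z;
  cmulZl : forall (a : R[i]) x y, cmul (a *: x) y = a *: cmul x y;
  cmulZr : forall (a : R[i]) x y, cmul x (a *: y) = a *: cmul x y;
  starK : forall x, star (star x) = x;
  starD : forall x y, star (x + y) = star x + star y;
  starZ : forall (a : R[i]) x, star (a *: x) = (Num.conj a) *: star x;
  starM : forall x y, star (cmul x y) = cmul (star y) (star x);
  cnormM : forall x y, `|cmul x y| <= `|x| * `|y|;
  cstar_norm : forall x, `|cmul (star x) x| = `|x| ^+ 2
}.

#[short(type="cstarType")]
HB.structure Definition Cstar (R : realType) :=
  {A of CompleteNormedModule R[i] A & CompleteNormedModule_isCstar R A}.

Notation "x ** y" := (cmul x y) (at level 40, left associativity) : ring_scope.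

HB.mixin Record CompleteNormedModule_isHilbert (R : realType) H
    of CompleteNormedModule R[i] H := {
  dot : H -> H -> R[i];
  dotDl : forall x y z, dot (x + y) z = dot x z + dot y z;
  dotZl : forall (a : R[i]) x y, dot (a *: x) y = a * dot x y;
  dotC : forall x y, dot y x = Num.conj (dot x y);
  dot_norm : forall x, `|x| ^+ 2 = dot x x
}.

#[short(type="hilbertType")]
HB.structure Definition Hilbert (R : realType) :=
  {H of CompleteNormedModule R[i] H & CompleteNormedModule_isHilbert R H}.

Section Cstar_algebras.
Variable R : realType.
Implicit Types A B C : cstarType R.

Definition is_unit A (e : A) := forall x, e ** x = x /\ x ** e = x.

(* *-homomorphisms between C*-algebras are automatically continuous, so the
   last clause does not restrict the notion. *)
Definition star_hom A B (phi : A -> B) :=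
  [/\ linear phi, forall x y, phi (x ** y) = phi x ** phi y,
      forall x, phi (star x) = star (phi x) & continuous phi].

(* A *-representation of A by bounded operators on H (not necessarily
   nondegenerate).  The bound always exists, with M = 1. *)
Definition is_rep A (H : hilbertType R) (pi : A -> H -> H) :=
  [/\ forall a, linear (pi a), forall xi, linear (fun a => pi a xi),
      forall a b xi, pi (a ** b) xi = pi a (pi b xi),
      forall a xi eta, dot (pi a xi) eta = dot xi (pi (star a) eta)
    & exists M : R[i], forall a xi, `|pi a xi| <= M * `|a| * `|xi|].

(* The squared norm of \sum_i xi_i (x) eta_i in the Hilbert space tensor
   product of H1 and H2. *)
Definition tensor_sqnorm (H1 H2 : hilbertType R) (I : finType)
    (xi : I -> H1) (eta : I -> H2) : R[i] :=
  \sum_i \sum_j dot (xi i) (xi j) * dot (eta i) (eta j).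

(* "For all representations pi of A on H1 and rho of B on H2, the operator
   \sum_i pi(a_i) (x) rho(b_i) on the Hilbert space tensor product of H1 and
   H2 has norm at most c": it is enough to test it on finite sums
   \sum_j xi_j (x) eta_j, which are dense. *)
Definition spatial_norm_le A B n (a : 'I_n -> A) (b : 'I_n -> B) (c : R[i]) :=
  forall (H1 H2 : hilbertType R) (pi : A -> H1 -> H1) (rho : B -> H2 -> H2),
  is_rep pi -> is_rep rho ->
  forall m (xi : 'I_m -> H1) (eta : 'I_m -> H2),
  tensor_sqnorm (fun ij : 'I_n * 'I_m => pi (a ij.1) (xi ij.2))
                (fun ij : 'I_n * 'I_m => rho (b ij.1) (eta ij.2))
    <= c ^+ 2 * tensor_sqnorm xi eta.

(* C, with the elementary tensors t, is the minimal (spatial) tensor product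
   of A and B: the completion of the algebraic tensor product for the norm
   x |-> sup { ||(pi (x) rho)(x)|| : pi, rho representations }.  The last
   clause says that the norm of C is this supremum; this being a norm on the
   algebraic tensor product, it also determines the kernel of the map from the
   algebraic tensor product to C. *)
Definition is_min_tensor A B C (t : A -> B -> C) :=
  [/\ forall b, linear (fun a => t a b),
      forall a, linear (t a),
      forall a a' b b', t a b ** t a' b' = t (a ** a') (b ** b'),
      forall a b, star (t a b) = t (star a) (star b)
    & dense [set x | exists n (a : 'I_n -> A) (b : 'I_n -> B),
                       x = \sum_i t (a i) (b i)]
      /\ forall n (a : 'I_n -> A) (b : 'I_n -> B) (c : R[i]), 0 <= c ->
           `|\sum_i t (a i) (b i)| <= c <-> spatial_norm_le a b c].

Record min_tensor A B := MinTensor {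
  min_tensor_sort :> cstarType R;
  tens : A -> B -> min_tensor_sort;
  tensP : is_min_tensor tens
}.

(* A (x) B (x) C, simultaneously viewed as (A (x) B) (x) C and A (x) (B (x) C). *)
Record min_tensor3 A B C (AB : min_tensor A B) (BC : min_tensor B C) :=
  MinTensor3 {
  min_tensor3_sort :> cstarType R;
  tensl : AB -> C -> min_tensor3_sort;
  tensr : A -> BC -> min_tensor3_sort;
  tenslP : is_min_tensor tensl;
  tensrP : is_min_tensor tensr;
  tenslr : forall a b c, tensl (tens AB a b) c = tensr a (tens BC b c)
}.

(* (alpha (x) id) alpha = (id (x) Delta) alpha, where h1 is alpha (x) id and
   h2 is id (x) Delta (both are unique, by density). *)
Definition coassociative A B (BA : min_tensor B A) (AA : min_tensor A A)
    (BAA : min_tensor3 BA AA) (alpha : B -> BA) (Delta : A -> AA) :=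
  exists h1 h2 : BA -> BAA,
  [/\ star_hom h1, forall b a, h1 (tens BA b a) = tensl BAA (alpha b) a,
      star_hom h2, forall b a, h2 (tens BA b a) = tensr BAA b (Delta a)
    & forall b, h1 (alpha b) = h2 (alpha b)].

Record compact_quantum_group := CompactQuantumGroup {
  cqg_sort :> cstarType R;
  cqg_one : cqg_sort;
  cqg_oneP : is_unit cqg_one;
  cqg_tens : min_tensor cqg_sort cqg_sort;
  cqg_tens3 : min_tensor3 cqg_tens cqg_tens;
  cqg_delta : cqg_sort -> cqg_tens;
  cqg_delta_hom : star_hom cqg_delta;
  cqg_delta1 : cqg_delta cqg_one = tens cqg_tens cqg_one cqg_one;
  cqg_coassoc : coassociative cqg_tens3 cqg_delta cqg_delta;
  cqg_densel : dense [set x | exists n (a b : 'I_n -> cqg_sort),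
    x = \sum_i cqg_delta (a i) ** tens cqg_tens (b i) cqg_one];
  cqg_denser : dense [set x | exists n (a b : 'I_n -> cqg_sort),
    x = \sum_i cqg_delta (a i) ** tens cqg_tens cqg_one (b i)]
}.

(* The existence of a unit of B is part of the assertion. *)
Definition is_coaction (Q : compact_quantum_group) B (BQ : min_tensor B Q)
    (BQQ : min_tensor3 BQ (cqg_tens Q)) (alpha : B -> BQ) :=
  [/\ star_hom alpha, coassociative BQQ alpha (@cqg_delta Q)
    & exists e : B,
      [/\ is_unit e, alpha e = tens BQ e (cqg_one Q)
        & dense [set x | exists n (b : 'I_n -> B) (a : 'I_n -> Q),
                   x = \sum_i alpha (b i) ** tens BQ e (a i)]]].

End Cstar_algebras.

Section Function_spaces.
Variables (R : realType) (X : finType).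

(* The functions on X: both C(X) and L^2(X).  For a C*-algebra A, the tensor
   product of this finite-dimensional space with A is {ffun X -> A}, where
   F stands for \sum_x chi_x (x) F x. *)
Definition chi (x : X) : {ffun X -> R[i]} := [ffun y => (y == x)%:R].

Variable A : cstarType R.
Definition coef (beta : {ffun X -> R[i]} -> {ffun X -> A}) (x y : X) : A :=
  beta (chi y) x.

End Function_spaces.

Section Finite_coactions.
Variables (R : realType) (Q : compact_quantum_group R) (X : finType).

(* Co-actions on C(X).  (alpha (x) id)(F) = \sum_y alpha(chi_y) (x) F y, and
   the C*-norm of C(X) (x) Q = {ffun X -> Q} is the maximum norm. *)
Definition is_fun_coaction (alpha : {ffun X -> R[i]} -> {ffun X -> Q}) :=
  [/\ linear alpha,
      forall (f g : {ffun X -> R[i]}) x,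
        alpha [ffun y => f y * g y] x = alpha f x ** alpha g x,
      forall (f : {ffun X -> R[i]}) x,
        alpha [ffun y => Num.conj (f y)] x = star (alpha f x),
      forall x, alpha [ffun=> 1] x = cqg_one Q
    & (forall f x,
         \sum_y tens (cqg_tens Q) (alpha (chi R y) x) (alpha f y)
           = cqg_delta (alpha f x))
      /\ forall (F : {ffun X -> Q}) (eps : R[i]), 0 < eps ->
           exists n (f : 'I_n -> {ffun X -> R[i]}) (a : 'I_n -> Q),
           forall x, `|F x - \sum_i alpha (f i) x ** a i| < eps].

(* X x X matrices over Q, i.e. elements of B(L^2(X)) (x) Q; the (x, y) entry
   is the coefficient of chi_x in the image of chi_y. *)
Definition mxmulQ (M N : X -> X -> Q) : X -> X -> Q :=
  fun x y => \sum_z M x z ** N z y.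
Definition mxadjQ (M : X -> X -> Q) : X -> X -> Q := fun x y => star (M y x).
Definition mxscalQ (T : X -> X -> R[i]) : X -> X -> Q :=
  fun x y => T x y *: cqg_one Q.
Definition mxoneQ : X -> X -> Q := mxscalQ (fun x y => (x == y)%:R).
Definition mxconjQ (M : X -> X -> Q) : X -> X -> Q := fun x y => star (M x y).

Definition is_unitary (U : X -> X -> Q) :=
  mxmulQ U (mxadjQ U) = mxoneQ /\ mxmulQ (mxadjQ U) U = mxoneQ.

Definition Ad (U : X -> X -> Q) (T : X -> X -> R[i]) : X -> X -> Q :=
  mxmulQ (mxmulQ U (mxscalQ T)) (mxadjQ U).

Definition is_corep (beta : {ffun X -> R[i]} -> {ffun X -> Q}) :=
  linear beta /\
  forall x y, cqg_delta (coef beta x y) =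
    \sum_z tens (cqg_tens Q) (coef beta x z) (coef beta z y).

Definition is_biunitary (beta : {ffun X -> R[i]} -> {ffun X -> Q}) :=
  is_unitary (coef beta) /\ is_unitary (mxconjQ (coef beta)).

End Finite_coactions.

Record multigraph := Multigraph {
  vert : finType;
  edge : finType;
  src : edge -> vert;
  tgt : edge -> vert
}.

Definition no_isolated (G : multigraph) :=
  forall v : vert G, exists e : edge G, src e = v \/ tgt e = v.

Definition is_src (G : multigraph) (v : vert G) := [exists e, src e == v].
Definition is_tgt (G : multigraph) (v : vert G) := [exists e, tgt e == v].

Definition Vs (G : multigraph) : finType := {v : vert G | is_src v}.
Definition Vt (G : multigraph) : finType := {v : vert G | is_tgt v}.

Lemma is_src_src (G : multigraph) (e : edge G) : is_src (src e).
Proof. by apply/existsP; exists e. Qed.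
Lemma is_tgt_tgt (G : multigraph) (e : edge G) : is_tgt (tgt e).
Proof. by apply/existsP; exists e. Qed.

Definition srcV (G : multigraph) (e : edge G) : Vs G := Sub (src e) (is_src_src e).
Definition tgtV (G : multigraph) (e : edge G) : Vt G := Sub (tgt e) (is_tgt_tgt e).

Section Graph_algebra.
Variables (R : realType) (G : multigraph).

Definition ck_family (D : cstarType R) (s : edge G -> D) (p : vert G -> D) :=
  [/\ forall e, s e ** star (s e) ** s e = s e,
      forall v, star (p v) = p v /\ p v ** p v = p v,
      forall v w, v != w -> p v ** p w = 0,
      forall e, star (s e) ** s e = p (tgt e)
    & forall v, is_src v -> \sum_(e | src e == v) s e ** star (s e) = p v].

Definition generates (D : cstarType R) (P : set D) :=
  forall W : set D, closed W -> P `<=` W ->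
    (forall (a : R[i]) x y, W x -> W y -> W (a *: x + y)) ->
    (forall x y, W x -> W y -> W (x ** y)) ->
    (forall x, W x -> W (star x)) ->
    W = setT.

(* The universal C*-algebra of the relations, characterized (up to
   isomorphism) by its universal property; being taken among all C*-algebras,
   it is not required to have a unit. *)
Definition is_graph_cstar (D : cstarType R) (s : edge G -> D) (p : vert G -> D) :=
  [/\ ck_family s p, generates (range s `|` range p)
    & forall (D' : cstarType R) (s' : edge G -> D') (p' : vert G -> D'),
        ck_family s' p' ->
        exists phi : D -> D', [/\ star_hom phi, forall e, phi (s e) = s' e
                                & forall v, phi (p v) = p' v]].

End Graph_algebra.

Section Banica.
Variables (R : realType) (Q : compact_quantum_group R) (G : multigraph).
Local Notation E := (edge G).
Local Notation V := (vert G).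

(* For M = R[i] these are S(f) and T(f), as matrices over the basis chi_e of
   L^2(E); for M = Q they are the elements of S(C(Vs)) (x) Q and
   T(C(Vt)) (x) Q. *)
Definition Smx (M : zmodType) (f : Vs G -> M) : E -> E -> M :=
  fun e e' => if e == e' then f (srcV e) else 0.
Definition Tmx (M : zmodType) (f : Vt G -> M) : E -> E -> M :=
  fun e e' => if e == e' then f (tgtV e) else 0.

(* The left C(Vs)- and right C(Vt)-actions on L^2(E), and their extensions
   with coefficients in Q. *)
Definition lact (f : {ffun Vs G -> R[i]}) (x : {ffun E -> R[i]}) :
  {ffun E -> R[i]} := [ffun e => f (srcV e) * x e].
Definition ract (x : {ffun E -> R[i]}) (f : {ffun Vt G -> R[i]}) :
  {ffun E -> R[i]} := [ffun e => x e * f (tgtV e)].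
Definition lactQ (f : {ffun Vs G -> Q}) (x : {ffun E -> Q}) :
  {ffun E -> Q} := [ffun e => f (srcV e) ** x e].
Definition ractQ (x : {ffun E -> Q}) (f : {ffun Vt G -> Q}) :
  {ffun E -> Q} := [ffun e => x e ** f (tgtV e)].

(* Extension by zero, i.e. the inclusions of C(Vs) (x) Q and C(Vt) (x) Q in
   C(V) (x) Q. *)
Definition ext0 (W : pred V) (F : {ffun {v : V | W v} -> Q}) : {ffun V -> Q} :=
  [ffun v => if insub v is Some w then F w else 0].

Implicit Types beta : {ffun E -> R[i]} -> {ffun E -> Q}.

Definition induced_src beta (alpha_s : {ffun Vs G -> R[i]} -> {ffun Vs G -> Q}) :=
  is_fun_coaction alpha_s /\
  forall i e, lactQ (alpha_s (chi R i)) (beta (chi R e))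
              = beta (lact (chi R i) (chi R e)).

Definition induced_tgt beta (alpha_t : {ffun Vt G -> R[i]} -> {ffun Vt G -> Q}) :=
  is_fun_coaction alpha_t /\
  forall j e, ractQ (beta (chi R e)) (alpha_t (chi R j))
              = beta (ract (chi R e) (chi R j)).

Definition preserve_and_agree
    (alpha_s : {ffun Vs G -> R[i]} -> {ffun Vs G -> Q})
    (alpha_t : {ffun Vt G -> R[i]} -> {ffun Vt G -> Q}) :=
  [/\ forall i k, is_tgt (val i) -> ~~ is_tgt (val k) -> alpha_s (chi R i) k = 0,
      forall j k, is_src (val j) -> ~~ is_src (val k) -> alpha_t (chi R j) k = 0
    & forall (i : Vs G) (j : Vt G), val i = val j ->
        ext0 (alpha_s (chi R i)) = ext0 (alpha_t (chi R j))].

Definition banica_coaction beta :=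
  [/\ is_corep beta /\ is_biunitary beta,
      forall f : Vs G -> R[i],
        exists F : Vs G -> Q, Ad (coef beta) (Smx f) = Smx F,
      forall f : Vt G -> R[i],
        exists F : Vt G -> Q, Ad (mxconjQ (coef beta)) (Tmx f) = Tmx F,
      exists alpha_s alpha_t,
        [/\ induced_src beta alpha_s, induced_tgt beta alpha_t
          & preserve_and_agree alpha_s alpha_t]
    & beta [ffun=> 1] = [ffun=> cqg_one Q]].

Definition is_induced beta (alpha : {ffun V -> R[i]} -> {ffun V -> Q}) :=
  linear alpha /\
  exists alpha_s alpha_t,
    [/\ induced_src beta alpha_s, induced_tgt beta alpha_t,
        forall i : Vs G, alpha (chi R (val i)) = ext0 (alpha_s (chi R i))
      & forall j : Vt G, alpha (chi R (val j)) = ext0 (alpha_t (chi R j))].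

End Banica.

(* Main.v *)
Require Import Defs.
From HB Require Import structures.
From mathcomp Require Import all_boot all_order all_algebra.
From mathcomp Require Import all_classical all_reals all_analysis.
From mathcomp Require Import complex ring.
Import Order.TTheory GRing.Theory Num.Theory.
Import numFieldNormedType.Exports.
Local Open Scope ring_scope.
Local Open Scope complex_scope.

Set Implicit Arguments.
Unset Strict Implicit.
Unset Printing Implicit Defensive.
Local Open Scope classical_set_scope.

(** Write [u] for the matrix of [beta], [q] for that of [alpha], and put in
    [C^*(G) (x) Q]
      [S_e = \sum_x s_x (x) u x e],   [P_i = \sum_k p_k (x) q k i].
    These elements again form a Cuntz-Krieger family ([coaction_ck_family]), so
    the universal property of [C^*(G)] yields the homomorphism [beta'].

    Since no vertex is isolated, each [p_v] is [s_e^* s_e] or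
    [\sum_e s_e s_e^*], and the [s_e] alone generate [C^*(G)].  Therefore
    coassociativity, an equality between two homomorphisms, follows from
    [Delta (u x y) = \sum_z u x z (x) u z y].  The density condition holds
    because the elements [b] such that [b (x) Q] and [b^* (x) Q] lie in the closed
    span of [beta'(b') (1 (x) a)] form a closed *-subalgebra, which contains [s_e]
    by the unitarity of [u] and of its entrywise adjoint.

    Three relations behind the Cuntz-Krieger family are not formal.

    - In an abstract C*-algebra, the ranges of the [s_e] with a common source are
      orthogonal, because projections whose sum is a projection are orthogonal
      ([proj_sum_absorb]).  The proof is a computation with norms: it rests on the
      fact that a self-adjoint [b] in the corner of [q] vanishes if [q + b] and
      [q - b] both lie in the unit ball ([corner_selfadjoint_eq0]).

    - [S_e^* S_e = P_(tgt e)] amounts to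
      [\sum_(x | tgt x = k) (u x e)^* u x e = q k (tgt e)], where the sum runs
      over the row index of [u]; it requires the column [q _ (tgt e)] to consist of
      orthogonal projections.  For a co-action on a finite set this is usually
      deduced from the antipode or the Haar state.  Here bi-unitarity of [u] makes
      the in-degree an invariant weight of [q], which gives [q] a left inverse; the
      density condition for [alpha_t] turns it into a two-sided one ([magic_col],
      [magic_col_sum]).

    - [P_i P_j = 0] when [i] is only a source and [j] only a target.  Both columns
      could meet in a row [k] that is a source and a target.  Counting the entries
      of [q] over the source-targets shows that [q k j = 0]
      ([coef_mixed_eq0]).

    The two sides of coassociativity are extensions to the minimal tensor product
    of maps [phi (x) psi] on elementary tensors.  They exist because a
    representation composed with a homomorphism is a representation, so that
    [phi (x) psi] is contractive for the spatial norm ([star_hom_tensor]). *)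

(** * Algebra in a C*-algebra *)

Section Cstar_algebra.
Variables (R : realType) (A : cstarType R).
Implicit Types (x y z a b p q f : A) (c : R[i]).

HB.instance Definition _ x := GRing.isLinear.Build R[i] A A *:%R (cmul x)
  (fun c y z => etrans (cmulDr x (c *: y) z)
                       (congr1 (+%R^~ (x ** z)) (cmulZr c x y))).
Definition cmulr y x := x ** y.
HB.instance Definition _ y := GRing.isLinear.Build R[i] A A *:%R (cmulr y)
  (fun c x z => etrans (cmulDl (c *: x) z y)
                       (congr1 (+%R^~ (z ** y)) (cmulZl c x y))).

Lemma cmul0x x : 0 ** x = 0. Proof. exact: (raddf0 (cmulr x)). Qed.
Lemma cmulx0 x : x ** 0 = 0. Proof. exact: (raddf0 (cmul x)). Qed.
Lemma cmulNx x y : (- x) ** y = - (x ** y).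
Proof. exact: (raddfN (cmulr y)). Qed.
Lemma cmulxN x y : x ** (- y) = - (x ** y).
Proof. exact: (raddfN (cmul x)). Qed.
Lemma cmulBl x y z : (x - y) ** z = x ** z - y ** z.
Proof. exact: (raddfB (cmulr z)). Qed.
Lemma cmulBr x y z : x ** (y - z) = x ** y - x ** z.
Proof. exact: (raddfB (cmul x)). Qed.

Lemma cmul_suml (I : Type) (r : seq I) (P : pred I) (F : I -> A) x :
  (\sum_(i <- r | P i) F i) ** x = \sum_(i <- r | P i) F i ** x.
Proof. exact: (raddf_sum (cmulr x)). Qed.
Lemma cmul_sumr (I : Type) (r : seq I) (P : pred I) (F : I -> A) x :
  x ** (\sum_(i <- r | P i) F i) = \sum_(i <- r | P i) x ** F i.
Proof. exact: (raddf_sum (cmul x)). Qed.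

Lemma star0 : star (0 : A) = 0.
Proof. by apply: (@addrI _ (star 0)); rewrite -starD !addr0. Qed.
Lemma starN x : star (- x) = - star x.
Proof. by apply/eqP; rewrite -subr_eq0 opprK -starD addNr star0. Qed.
Lemma starB x y : star (x - y) = star x - star y.
Proof. by rewrite starD starN. Qed.
Lemma star_sum (I : Type) (r : seq I) (P : pred I) (F : I -> A) :
  star (\sum_(i <- r | P i) F i) = \sum_(i <- r | P i) star (F i).
Proof. by apply: (big_morph _ starD star0). Qed.

Lemma star_norm x : `|star x| = `|x|.
Proof.
have le y : `|y| <= `|star y|.
  have [->|y0] := eqVneq y 0; first by rewrite star0.
  rewrite -(@ler_pM2r _ `|y|) ?normr_gt0// -expr2 -cstar_norm.
  exact: cnormM.
by apply/eqP; rewrite eq_le le -{2}(starK x) le.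
Qed.

Lemma star_mul_eq0 x : star x ** x = 0 -> x = 0.
Proof.
by move=> h; apply/eqP; rewrite -normr_eq0 -sqrf_eq0 -cstar_norm h normr0.
Qed.

Definition is_proj p := star p = p /\ p ** p = p.

Lemma is_proj0 : is_proj 0. Proof. by rewrite /is_proj star0 cmul0x. Qed.

Lemma proj_norm_le1 p : is_proj p -> `|p| <= 1.
Proof.
move=> [sp pp]; have := cstar_norm p; rewrite sp pp => e.
have [->|p0] := eqVneq `|p| 0; first exact: ler01.
suff -> : `|p| = 1 by [].
by apply: (mulfI p0); rewrite mulr1 -expr2.
Qed.

(** Left multiplication by the complement of a projection is contractive, in
    an algebra that need not contain [1 - f]: with [y = x - f x] one has
    [y^* y = x^* y]. *)
Lemma proj_norm_compl f x : is_proj f -> `|x - f ** x| <= `|x|.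
Proof.
move=> [sf ff]; set y := x - f ** x.
have [->|y0] := eqVneq y 0; first by rewrite normr0.
rewrite -(@ler_pM2r _ `|y|) ?normr_gt0// -expr2 -cstar_norm.
have -> : star y ** y = star x ** y.
  rewrite {1}/y starB cmulBl starM sf -cmulA [f ** y]cmulBr cmulA ff.
  by rewrite subrr cmulx0 subr0.
by rewrite -(star_norm x) cnormM.
Qed.

End Cstar_algebra.

(** * Projections whose sum is a projection *)

Lemma archimedean_eq0 (R : realType) (x y : R) :
  0 <= x -> (forall n, x *+ n <= y) -> x = 0.
Proof.
move=> x0 h; apply/eqP; rewrite eq_le x0 andbT leNgt; apply/negP => xgt0.
have y0 : 0 <= y by rewrite (le_trans _ (h 0%N)).
have := archi_boundP (divr_ge0 y0 x0); rewrite ltr_pdivrMr// mulr_natl.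
by rewrite ltNge h.
Qed.

Section Projections.
Variables (R : realType) (A : cstarType R).
Implicit Types (x y z a b p q f : A) (c : R[i]).

Lemma norm_mean_le1 x y : `|x| <= 1 -> `|y| <= 1 -> `|(2^-1 : R[i]) *: (x + y)| <= 1.
Proof.
move=> hx hy; rewrite normrZ ger0_norm ?invr_ge0 ?ler0n//.
rewrite ler_pdivrMl ?ltr0n// mulr1 (le_trans (ler_normD _ _))//.
exact: lerD.
Qed.

Lemma cmul_parallelogram x y :
  (x + y) ** (x + y) + (x - y) ** (x - y) = (x ** x + y ** y) *+ 2.
Proof.
rewrite !cmulDl !cmulDr !cmulxN !cmulNx opprK addrACA.
rewrite [X in X + _ = _]addrACA subrr addr0 [X in _ + X = _]addrACA subrr add0r.
by rewrite addrACA -mulr2n.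
Qed.

Lemma norm_sqr_le1 x : `|x| <= 1 -> `|x ** x| <= 1.
Proof. by move=> hx; rewrite (le_trans (cnormM _ _))// mulr_ile1. Qed.

(** The hypothesis passes from [b] to [(1 + i) b], because the terms in [b ^ 2]
    cancel in [(q + c b)^2 + (q + i c b)^2].  As the powers of [1 + i] are
    unbounded while [b] is bounded by 2, this forces [b = 0]. *)
Lemma corner_rotations_eq0 q b : is_proj q -> q ** b = b -> b ** q = b ->
  (forall k, `|q + ('i%R : R[i]) ^+ k *: b| <= 1) -> b = 0.
Proof.
move=> qP; have [_ qq] := qP.
pose K b := [/\ q ** b = b, b ** q = b &
  forall k, `|q + ('i%R : R[i]) ^+ k *: b| <= 1].
move=> qb bq hb; have {qb bq hb} : K b by [].
have sqr_qc b' c : q ** b' = b' -> b' ** q = b' ->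
    (q + c *: b') ** (q + c *: b') = q + (c *+ 2) *: b' + c ^+ 2 *: (b' ** b').
  move=> qb bq; rewrite cmulDl !cmulDr qq !cmulZl !cmulZr qb bq scalerA -expr2.
  by rewrite -!addrA; congr (_ + _); rewrite addrA -scalerDl -mulr2n.
have Krot b' : K b' -> K ((1 + 'i%R : R[i]) *: b').
  move=> [qb bq hb]; split; rewrite ?cmulZr ?cmulZl ?qb ?bq// => k.
  have := norm_mean_le1 (norm_sqr_le1 (hb k)) (norm_sqr_le1 (hb k.+1)).
  rewrite !sqr_qc// [_ ^+ k.+1]exprS exprMn sqrCi mulN1r scaleNr.
  set i := ('i%R : R[i]); set u := i ^+ k.
  set bb := u ^+ 2 *: _; rewrite addrACA subrr addr0 addrACA -mulr2n.
  rewrite scalerDr -[q *+ 2]scaler_nat -scalerDl !scalerA mulVf ?pnatr_eq0//.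
  rewrite scale1r -mulrnDl -(mulr_natl (u + _)) mulrA mulVf ?pnatr_eq0// mul1r.
  by rewrite mulrDr mulr1 [u * i]mulrC.
(* (1 + i)^2 = 2 i, and multiplication by i preserves K *)
have Kdouble b' : K b' -> K ((2%:R : R[i]) *: b').
  move=> /Krot/Krot; rewrite scalerA -expr2 sqrrD expr1n mul1r sqrCi => -[qb bq hb].
  have i3 : ('i%R : R[i]) ^+ 3 * 'i%R = 1.
    by rewrite -exprSr -[4%N]/(2 * 2)%N exprM sqrCi sqrrN expr1n.
  have e : (2%:R : R[i]) *: b' = 'i%R ^+ 3 *: ((1 + 'i%R *+ 2 - 1) *: b').
    by rewrite addrAC subrr add0r scalerA mulrnAr i3.
  set d := _ *: b' in qb bq hb e *; rewrite e.
  split; rewrite ?cmulZr ?cmulZl; first by rewrite -cmulZr qb.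
    by rewrite -cmulZl bq.
  by move=> k; rewrite scalerA -exprD.
move=> Kb; have Kn n : K (((2 ^ n)%:R : R[i]) *: b).
  elim: n => [|n IHn]; first by rewrite scale1r.
  by rewrite expnS natrM -scalerA; exact: Kdouble.
have bound n : `|b| *+ (2 ^ n) <= 2%:R.
  have [_ _ /(_ 0)] := Kn n; rewrite expr0 scale1r => h.
  rewrite -[X in X <= _]mulr_natl -[X in X * _]normr_nat -normrZ.
  set d := _ *: b in h *; have -> : d = (q + d) - q by rewrite addrAC subrr add0r.
  rewrite (le_trans (ler_normB _ _))// (_ : 2%:R = 1 + 1)// lerD//.
  exact: proj_norm_le1.
apply/eqP; rewrite -normr_eq0; apply/eqP.
move: (normr_ge0 b) bound; case: `|b| => x y.
rewrite lecE /= => /andP[/eqP -> x0] h.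
suff -> : x = 0 by [].
apply: (@archimedean_eq0 R x 2%:R) => // n; have := h n.
rewrite (_ : (x +i* 0) = x%:C)// -(rmorphMn (real_complex R)).
rewrite -[2%:R](rmorph_nat (real_complex R)) lecR; apply: le_trans.
by apply: ler_wpMn2l => //; exact/ltnW/ltn_expl.
Qed.

(** For self-adjoint [b] the bounds at [1] and [-1] imply those at [i] and
    [-i], as [|q + i b|^2 = |q + b^2|] and [q + b^2] is the mean of the squares of
    [q + b] and [q - b]. *)
Lemma corner_selfadjoint_eq0 q b : is_proj q -> star b = b -> q ** b = b ->
  `|q + b| <= 1 -> `|q - b| <= 1 -> b = 0.
Proof.
move=> qP sb qb hp hm; have [sq qq] := qP.
have bq : b ** q = b by rewrite -sb -{1}sq -starM qb.
have hi c : c ^+ 2 = -1 -> Num.conj c = - c -> `|q + c *: b| <= 1.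
  move=> c2 cc; rewrite -(@ler_pXn2r _ 2) ?nnegrE// -cstar_norm expr1n.
  have -> : star (q + c *: b) ** (q + c *: b) = q + b ** b.
    rewrite starD starZ cc sq sb cmulDl !cmulDr qq !cmulZl !cmulZr qb bq.
    rewrite scalerA mulNr -expr2 c2 opprK scale1r scaleNr.
    by rewrite addrA addrK.
  suff -> : q + b ** b = (2^-1 : R[i]) *:
      ((q + b) ** (q + b) + (q - b) ** (q - b)).
    by apply: norm_mean_le1; exact: norm_sqr_le1.
  rewrite cmul_parallelogram qq -[(q + _) *+ 2]scaler_nat scalerA.
  by rewrite mulVf ?pnatr_eq0// scale1r.
apply: (corner_rotations_eq0 qP) => // k.
pose both k := `|q + ('i%R : R[i]) ^+ k *: b| <= 1 /\
               `|q - ('i%R : R[i]) ^+ k *: b| <= 1.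
suff: both k /\ both k.+1 by case=> -[].
rewrite /both; clear both.
elim: k => [|k [[h1 h2] [h3 h4]]].
  rewrite expr0 expr1 scale1r -scaleNr; split=> //.
  split; apply: hi; rewrite ?sqrrN ?sqrCi//.
    exact: conjCi.
  exact: etrans (rmorphN _ _) (congr1 -%R (conjCi _)).
split=> //; rewrite -addn2 exprD sqrCi mulrN1 scaleNr opprK; split => //.
Qed.

(** The bound [|q - a i| <= 1] plays the role of [0 <= a i]: it says that
    positive elements of sum zero vanish.  With [N] the number of terms,
    [N q + a i] is the sum of [q] and of the [q - a j] for [j != i], so
    [a i / N] satisfies the hypotheses of [corner_selfadjoint_eq0]. *)
Lemma balanced_corner_eq0 (I : finType) q (a : I -> A) : is_proj q ->
  (forall i, star (a i) = a i) -> (forall i, q ** a i = a i) ->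
  (forall i, `|q - a i| <= 1) -> \sum_i a i = 0 -> forall i, a i = 0.
Proof.
move=> qP sa qa na suma i; set N := (#|I|%:R : R[i]).
have N0 : 0 < N by rewrite ltr0n; apply/card_gt0P; exists i.
have q1 := proj_norm_le1 qP.
suff b0 : N^-1 *: a i = 0.
  by move/eqP: b0; rewrite scaler_eq0 invr_eq0 gt_eqF//= => /eqP.
have scal x : `|N *: q + x| <= N -> `|q + N^-1 *: x| <= 1.
  move=> h; rewrite -(scalerK (lt0r_neq0 N0) q) -scalerDr normrZ.
  by rewrite ger0_norm ?invr_ge0 ?(ltW N0)// ler_pdivrMl// mulr1.
have bound (y : I -> A) : (forall j, `|y j| <= 1) -> `|\sum_j y j| <= N.
  move=> hy; rewrite (le_trans (ler_norm_sum _ _ _))//.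
  by rewrite (le_trans (ler_sum _ (fun j _ => hy j)))// sumr_const.
have Nq : N *: q = \sum_(j : I) q by rewrite sumr_const scaler_nat.
apply: (corner_selfadjoint_eq0 qP).
- by rewrite starZ sa fmorphV /N rmorph_nat.
- by rewrite cmulZr qa.
- apply: scal; have -> : N *: q + a i = \sum_j (if j == i then q else q - a j).
    rewrite Nq (bigD1 i)//= [in RHS](bigD1 i)//= eqxx.
    move/eqP: suma; rewrite (bigD1 i)//= addr_eq0 => /eqP ->.
    rewrite -addrA; congr (_ + _).
    rewrite -sumrB; apply: eq_bigr => j /negPf ->; by [].
  by apply: bound => j; case: ifP.
- rewrite -scalerN; apply: scal.
  have -> : N *: q - a i = \sum_j (if j == i then q - a i else q).
    rewrite Nq (bigD1 i)//= [in RHS](bigD1 i)//= eqxx addrAC; congr (_ + _).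
    by apply: eq_bigr => j /negPf ->.
  by apply: bound => j; case: ifP.
Qed.

(** In the corner of [q i], the elements [q_i q_j q_i] for [j != i] and
    [q_i - q_i p q_i] are positive and their sum is zero.  They are the squares
    [x^* x] of [q_j q_i] and of [q_i - p q_i]. *)
Lemma proj_sum_absorb (I : finType) (q : I -> A) p : (forall i, is_proj (q i)) ->
  is_proj p -> \sum_i q i = p ->
  forall i, p ** q i = q i /\ forall j, j != i -> q j ** q i = 0.
Proof.
move=> qP pP sumq i; have [sq qq] := qP i; have [sp pp] := pP.
have corner f : is_proj f ->
    star (q i - f ** q i) ** (q i - f ** q i) = q i - q i ** f ** q i.
  move=> [sf ff]; rewrite starB starM sq sf cmulBl !cmulBr qq -!cmulA.
  by rewrite [f ** (f ** _)]cmulA ff subrr subr0.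
have corner1 f : is_proj f -> `|q i - q i ** f ** q i| <= 1.
  move=> fP; rewrite -corner// cstar_norm expr_le1//.
  by rewrite (le_trans (proj_norm_compl _ fP))// proj_norm_le1.
pose a j := if j == i then q i - q i ** p ** q i else q i ** q j ** q i.
have a0 : forall j, a j = 0.
  apply: (balanced_corner_eq0 (qP i)) => [j|j|j|].
  - have [sj _] := qP j; rewrite /a; case: ifP => _.
      by rewrite starB !starM sq sp cmulA.
    by rewrite !starM sq sj cmulA.
  - by rewrite /a; case: ifP => _; rewrite ?cmulBr !cmulA qq.
  - rewrite /a; case: ifP => _; last exact: corner1.
    rewrite opprB addrC addrNK (le_trans (cnormM _ _))//.
    apply: mulr_ile1 => //; last exact: proj_norm_le1.
    by rewrite (le_trans (cnormM _ _))// mulr_ile1 ?proj_norm_le1.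
  - rewrite (bigD1 i)//= {1}/a eqxx.
    rewrite (eq_bigr (fun j => q i ** q j ** q i)); last first.
      by move=> j /negPf h; rewrite /a h.
    rewrite -[p]sumq cmul_sumr cmul_suml (bigD1 i)//= !qq.
    by rewrite opprD addrA subrr sub0r addNr.
split=> [|j ji].
  have := a0 i; rewrite /a eqxx -corner// => /star_mul_eq0/eqP.
  by rewrite subr_eq0 => /eqP <-.
have := a0 j; rewrite /a (negPf ji) => h.
have [sj qj] := qP j; apply: star_mul_eq0.
by rewrite starM sq sj cmulA -[q i ** q j ** q j]cmulA qj.
Qed.

End Projections.

(** * Cuntz-Krieger families *)

Section Cuntz_Krieger.
Variables (R : realType) (G : multigraph) (D : cstarType R).
Variables (s : edge G -> D) (p : vert G -> D).
Hypothesis ckP : ck_family s p.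

Lemma ck_proj v : is_proj (p v).
Proof. by have [_ h _ _ _] := ckP; exact: h. Qed.

Lemma ck_projM v w : p v ** p w = if v == w then p v else 0.
Proof.
have [_ h h0 _ _] := ckP; case: eqVneq => [<-|/h0//].
by have [] := h v.
Qed.

Lemma ck_range_proj e : is_proj (s e ** star (s e)).
Proof.
have [h _ _ _ _] := ckP.
by split; [rewrite starM starK | rewrite cmulA h].
Qed.

Lemma ck_tgt e : s e ** p (tgt e) = s e.
Proof. by have [h _ _ <- _] := ckP; rewrite cmulA h. Qed.

(** [p (src e)] is the sum of the range projections of the edges starting at
    [src e], hence it absorbs that of [e]. *)
Lemma ck_src e : p (src e) ** s e = s e.
Proof.
have [h pP _ _ sumE] := ckP.
have [sP pp] := pP (src e).
pose q f := if src f == src e then s f ** star (s f) else 0.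
have qP f : is_proj (q f).
  rewrite /q; case: ifP => _; first exact: ck_range_proj.
  exact: is_proj0.
have sumq : \sum_f q f = p (src e) by rewrite -sumE ?is_src_src// [RHS]big_mkcond.
have [] := proj_sum_absorb qP (pP _) sumq e.
rewrite /q eqxx => pe _.
by rewrite -{1}(h e) cmulA pe h.
Qed.

Lemma ck_starM e f : star (s e) ** s f = if e == f then p (tgt e) else 0.
Proof.
have [h pP _ hs sumE] := ckP.
case: eqVneq => [<-//|ef].
have [sef|sef] := eqVneq (src e) (src f); last first.
  rewrite -(ck_src e) -(ck_src f) starM cmulA.
  have [-> _] := pP (src e); rewrite -[_ ** p _ ** p _]cmulA.
  by rewrite ck_projM (negPf sef) cmulx0 cmul0x.
pose q g := if src g == src f then s g ** star (s g) else 0.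
have qP g : is_proj (q g).
  rewrite /q; case: ifP => _; first exact: ck_range_proj.
  exact: is_proj0.
have sumq : \sum_g q g = p (src f) by rewrite -sumE ?is_src_src// [RHS]big_mkcond.
have [_ /(_ e ef)] := proj_sum_absorb qP (pP _) sumq f.
rewrite /q eqxx sef eqxx => h0.
have -> : star (s e) ** s f =
    star (s e) ** (s e ** star (s e) ** (s f ** star (s f))) ** s f.
  rewrite !cmulA; rewrite -[in LHS](h f) -[X in star X ** _](h e).
  by rewrite !starM starK !cmulA.
by rewrite h0 cmulx0 cmul0x.
Qed.

Lemma ck_projs v e : p v ** s e = if v == src e then s e else 0.
Proof.
rewrite -[in LHS]ck_src cmulA ck_projM; case: eqVneq => [->|_]; first exact: ck_src.
by rewrite cmul0x.
Qed.

Lemma ck_sproj e v : s e ** p v = if v == tgt e then s e else 0.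
Proof.
rewrite -[in LHS]ck_tgt -cmulA ck_projM [v == _]eq_sym.
by case: eqVneq => _; rewrite ?ck_tgt ?cmulx0.
Qed.

Definition ck_unit := \sum_v p v.

Lemma ck_unit_star : star ck_unit = ck_unit.
Proof. by rewrite star_sum; apply: eq_bigr => v _; have [] := ck_proj v. Qed.

Lemma ck_unit_s e : ck_unit ** s e = s e /\ s e ** ck_unit = s e.
Proof.
rewrite cmul_suml cmul_sumr; split.
  by rewrite (bigD1 (src e))//= ck_projs eqxx big1 ?addr0// => v /negPf h;
     rewrite ck_projs h.
by rewrite (bigD1 (tgt e))//= ck_sproj eqxx big1 ?addr0// => v /negPf h;
   rewrite ck_sproj h.
Qed.

End Cuntz_Krieger.

(** * Approximation in normed spaces *)

Lemma norm_arbitrarily_small_eq0 (K : numFieldType) (V : normedModType K) (x : V) :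
  (forall eps : K, 0 < eps -> `|x| <= eps) -> x = 0.
Proof.
move=> h; apply/eqP; rewrite -normr_eq0 eq_le normr_ge0 andbT.
rewrite real_leNgt ?normr_real//; apply/negP => x0.
have := h (`|x| / 2) (divr_gt0 x0 (@ltr0Sn _ _)).
rewrite ler_pdivlMr// mulr_natr mulr2n gerDl => /(lt_le_trans x0).
by rewrite ltxx.
Qed.

Section Approximation.
Variables (K : numFieldType) (V W : normedModType K).

(** Membership in the closure, in the metric form in which it is used. *)
Definition approx (S : set V) (x : V) :=
  forall eps : K, 0 < eps -> exists2 y, S y & `|x - y| < eps.

Lemma approx_closed (S : set V) : (forall x, approx S x -> S x) -> closed S.
Proof.
move=> h x clx; apply: h => eps eps0.
have [y [Sy]] := clx _ (nbhsx_ballx x eps eps0).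
by rewrite -ball_normE => xy; exists y.
Qed.

Lemma denseP (S : set V) : dense S <-> forall x, approx S x.
Proof.
split=> [dS x eps eps0|h O [x Ox] Oopen].
  have [||y [bxy Sy]] := dS (ball x eps); [|exact: ball_open|].
    by exists x; exact: ballxx.
  by exists y => //; move: bxy; rewrite -ball_normE.
have /nbhs_ballP[eps eps0 sub] : nbhs x O by exact: open_nbhs_nbhs.
have [y Sy xy] := h x eps eps0.
by exists y; split=> //; apply: sub; rewrite -ball_normE.
Qed.

Lemma continuous_linear_bound (f : V -> W) : linear f -> continuous f ->
  exists2 k : K, 0 < k & forall x, `|f x| <= k * `|x|.
Proof.
move=> lf cf; pose g := GRing.isLinear.Build K V W *:%R f lf.
pose F : {linear V -> W} := HB.pack f g.
have /linear_boundedP/pinfty_ex_gt0[k k0 hk] : bounded_near F (nbhs (0 : V)).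
  exact/linear_bounded_continuous.
by exists k.
Qed.

Lemma bound_linear_continuous (f : V -> W) (k : K) : linear f -> 0 <= k ->
  (forall x, `|f x| <= k * `|x|) -> continuous f.
Proof.
move=> lf k0 fk; pose g := GRing.isLinear.Build K V W *:%R f lf.
pose F : {linear V -> W} := HB.pack f g.
apply: (@bounded_linear_continuous _ _ _ F); apply/linear_boundedP.
near=> r => x; rewrite (le_trans (fk x))// ler_wpM2r//.
by near: r; apply: nbhs_pinfty_ge; exact: ger0_real.
Unshelve. all: by end_near. Qed.

Lemma approx_equalizer (f g : V -> W) x : linear f -> continuous f ->
  linear g -> continuous g -> approx [set y | f y = g y] x -> f x = g x.
Proof.
move=> fL fC gL gC hx.
have [k k0 hk] := continuous_linear_bound fL fC.
have [l l0 hl] := continuous_linear_bound gL gC.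
apply/eqP; rewrite -subr_eq0; apply/eqP; apply: norm_arbitrarily_small_eq0.
move=> eps eps0; have kl : 0 < k + l by rewrite addr_gt0.
have [y fgy xy] := hx _ (divr_gt0 eps0 kl).
have -> : f x - g x = f (x - y) - g (x - y).
  rewrite (zmod_morphism_linear fL) (zmod_morphism_linear gL) fgy.
  by rewrite opprB addrA addrNK.
rewrite (le_trans (ler_normB _ _))// (le_trans (lerD (hk _) (hl _)))//.
by rewrite -mulrDl mulrC -ler_pdivlMr// ltW.
Qed.

Lemma approx_approx (S : set V) x : approx (approx S) x -> approx S x.
Proof.
move=> hx eps eps0; have e2 : 0 < eps / 2 by rewrite divr_gt0.
have [y Sy xy] := hx _ e2; have [z Sz yz] := Sy _ e2.
exists z => //; rewrite -(subrKA y) (le_lt_trans (ler_normD _ _))//.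
by rewrite [eps]splitr ltrD.
Qed.

Lemma linear_approx (a : K) (x y : V) (eps : K) : 0 < eps ->
  exists2 d, 0 < d & forall x' y', `|x - x'| < d -> `|y - y'| < d ->
    `|(a *: x + y) - (a *: x' + y')| < eps.
Proof.
move=> eps0; have a1 : 0 < `|a| + 1 by rewrite ltr_wpDl.
exists (eps / (`|a| + 1)) => [|x' y' hx hy]; first by rewrite divr_gt0.
rewrite opprD addrACA -scalerBr (le_lt_trans (ler_normD _ _))// normrZ.
have -> : eps = `|a| * (eps / (`|a| + 1)) + eps / (`|a| + 1).
  by rewrite -{2}[eps / _]mul1r -mulrDl mulrC divfK// gt_eqF.
by rewrite ler_ltD// ler_wpM2l// ltW.
Qed.

End Approximation.

Lemma pos_lower_bound (K : numFieldType) (e1 e2 : K) : 0 < e1 -> 0 < e2 ->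
  exists e, [/\ 0 < e, e <= e1 & e <= e2].
Proof.
move=> e10 e20; have [le|lt] := real_leP (gtr0_real e10) (gtr0_real e20).
  by exists e1.
by exists e2; split=> //; exact: ltW.
Qed.

Lemma cmul_approx (R : realType) (A : cstarType R) (x y : A) (eps : R[i]) :
  0 < eps ->
  exists2 d, 0 < d & forall x' y', `|x - x'| < d -> `|y - y'| < d ->
    `|x ** y - x' ** y'| < eps.
Proof.
move=> eps0; have k0 : 0 < `|x| + (`|y| + 1) + 1 by rewrite ltr_wpDl// !addr_ge0.
set k := (X in 0 < X) in k0.
have ek : 0 < eps / k by rewrite divr_gt0.
have [d [d0 de d1]] := pos_lower_bound ek (@ltr01 R[i]).
exists d => // x' y' hx hy.
have -> : x ** y - x' ** y' = x ** (y - y') + (x - x') ** y'.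
  by rewrite cmulBr cmulBl addrA addrNK.
have y'1 : `|y'| <= `|y| + 1.
  rewrite -[y'](subKr y) (le_trans (ler_normB _ _))// lerD2l.
  by rewrite (le_trans (ltW hy)).
have -> : eps = k * (eps / k) by rewrite mulrC divfK// gt_eqF.
rewrite (le_lt_trans (ler_normD _ _))//.
apply: (@le_lt_trans _ _ ((`|x| + (`|y| + 1)) * d)).
  rewrite mulrDl lerD// (le_trans (cnormM _ _))//.
    by rewrite ler_wpM2l// ltW.
  by rewrite mulrC ler_pM// ltW.
rewrite (@lt_le_trans _ _ (k * d))//.
  by rewrite ltr_pM2r// ltrDl.
by rewrite ler_pM2l.
Qed.

(** * Extension of contractive homomorphisms *)

(** A homomorphism defined on a dense *-subalgebra is given here by its graph
    [Gr]: elements of an algebraic tensor product have many expressions as sums of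
    elementary tensors, and [Gr_le] makes the value independent of the choice. *)
Section Graph_extension.
Variables (R : realType) (C D : cstarType R).
Variable Gr : C -> D -> Prop.
Hypothesis GrL : forall (a : R[i]) x y x' y', Gr x y -> Gr x' y' ->
  Gr (a *: x + x') (a *: y + y').
Hypothesis GrM : forall x y x' y', Gr x y -> Gr x' y' -> Gr (x ** x') (y ** y').
Hypothesis GrS : forall x y, Gr x y -> Gr (star x) (star y).
Hypothesis Gr_le : forall x y, Gr x y -> `|y| <= `|x|.
Hypothesis Gr_dense : dense [set x | exists y, Gr x y].

Definition graph_closure x y := forall eps : R[i], 0 < eps ->
  exists x' y', [/\ Gr x' y', `|x - x'| < eps & `|y - y'| < eps].

Lemma graph_sub x y x' y' : Gr x y -> Gr x' y' -> Gr (x - x') (y - y').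
Proof. by move=> h h'; have := GrL (-1) h' h; rewrite !scaleN1r ![- _ + _]addrC. Qed.

(** The values of [Gr] at the points near [x] form a Cauchy filter. *)
Lemma graph_closure_ex x : exists y, graph_closure x y.
Proof.
pose B eps := [set y | exists2 x', Gr x' y & `|x - x'| < eps].
have B0 eps : 0 < eps -> B eps !=set0.
  move/denseP: Gr_dense => /(_ x) /[apply] -[x' [y xy] xx'].
  by exists y, x'.
pose F := filter_from [set eps : R[i] | 0 < eps] B.
have FF : ProperFilter F.
  apply: filter_from_proper => //.
  apply: filter_from_filter; first by exists 1; exact: ltr01.
  move=> e1 e2 e10 e20.
  have [le|le] := real_leP (gtr0_real e10) (gtr0_real e20).
    exists e1 => // y [x' xy xx']; split; exists x' => //; exact: lt_le_trans le.
  exists e2 => // y [x' xy xx']; split; exists x' => //; exact: lt_trans le.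
have : cauchy F.
  apply: cauchy_exP => eps eps0.
  have e2 : 0 < eps / 2 by rewrite divr_gt0.
  have [y [x' xy xx']] := B0 _ e2.
  exists y; exists (eps / 2) => // z [x'' xz xx'']; rewrite -ball_normE /=.
  rewrite (le_lt_trans (Gr_le (graph_sub xy xz)))//.
  rewrite -(subrKA x) (le_lt_trans (ler_normD _ _))// [eps]splitr ltrD//.
  by rewrite distrC.
move=> /cauchy_cvg/cvg_ex[y Fy]; exists y => eps eps0.
have [e e0 Be] : F (ball y eps) by apply: Fy; exact: nbhsx_ballx.
have [|z [x' xz xx']] := B0 (Num.min e eps).
  by rewrite /Num.min; case: ifP.
have hlt : `|x - x'| < e /\ `|x - x'| < eps.
  move: xx'; rewrite /Num.min; case: (real_ltP (gtr0_real e0) (gtr0_real eps0)).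
    by move=> h1 h2; split=> //; exact: lt_trans h1.
  by move=> h1 h2; split=> //; exact: lt_le_trans h1.
exists x', z; split=> //; first exact: hlt.2.
have := Be z; rewrite -ball_normE; apply.
by exists x' => //; exact: hlt.1.
Qed.

Lemma graph_closure_linear (a : R[i]) x y x1 y1 :
  graph_closure x y -> graph_closure x1 y1 ->
  graph_closure (a *: x + x1) (a *: y + y1).
Proof.
move=> h h1 eps eps0.
have [d d0 hd] := linear_approx a x x1 eps0.
have [d' d'0 hd'] := linear_approx a y y1 eps0.
have [e [e0 ed ed']] := pos_lower_bound d0 d'0.
have [x' [y' [xy' xx' yy']]] := h e e0.
have [x1' [y1' [xy1' xx1' yy1']]] := h1 e e0.
exists (a *: x' + x1'), (a *: y' + y1'); split; first exact: GrL.
  by apply: hd; exact: lt_le_trans ed.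
by apply: hd'; exact: lt_le_trans ed'.
Qed.

Lemma graph_closureM x y x1 y1 :
  graph_closure x y -> graph_closure x1 y1 ->
  graph_closure (x ** x1) (y ** y1).
Proof.
move=> h h1 eps eps0.
have [d d0 hd] := cmul_approx x x1 eps0.
have [d' d'0 hd'] := cmul_approx y y1 eps0.
have [e [e0 ed ed']] := pos_lower_bound d0 d'0.
have [x' [y' [xy' xx' yy']]] := h e e0.
have [x1' [y1' [xy1' xx1' yy1']]] := h1 e e0.
exists (x' ** x1'), (y' ** y1'); split; first exact: GrM.
  by apply: hd; exact: lt_le_trans ed.
by apply: hd'; exact: lt_le_trans ed'.
Qed.

Lemma graph_closure_star x y :
  graph_closure x y -> graph_closure (star x) (star y).
Proof.
move=> h eps /h[x' [y' [xy' xx' yy']]]; exists (star x'), (star y').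
by split; [exact: GrS | rewrite -starB star_norm..].
Qed.

Lemma graph_closure_le x y : graph_closure x y -> `|y| <= `|x|.
Proof.
move=> h; rewrite real_leNgt ?normr_real//; apply/negP => xy.
have e0 : 0 < (`|y| - `|x|) / 2 by rewrite divr_gt0// subr_gt0.
have [x' [y' [xy' xx' yy']]] := h _ e0.
suff : `|y| < `|y| by rewrite ltxx.
rewrite -{1}(addrNK y' y) (le_lt_trans (ler_normD _ _))//.
have -> : `|y| = (`|y| - `|x|) / 2 + ((`|y| - `|x|) / 2 + `|x|).
  by rewrite addrA -splitr addrNK.
rewrite ltr_leD// (le_trans (Gr_le xy'))//.
rewrite -(addrNK x x') (le_trans (ler_normD _ _))// lerD2r distrC.
exact: ltW.
Qed.

Lemma graph_closure_inj x y y' : graph_closure x y -> graph_closure x y' -> y = y'.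
Proof.
move=> h h'; have /graph_closure_le := graph_closure_linear (-1) h h'.
rewrite !scaleN1r addNr normr0 normr_le0 addrC subr_eq0.
by move/eqP.
Qed.

Lemma graph_closure_sub x y : Gr x y -> graph_closure x y.
Proof. by move=> xy eps eps0; exists x, y; rewrite !subrr !normr0. Qed.

Lemma star_hom_of_graph :
  exists2 h : C -> D, star_hom h & forall x y, Gr x y -> h x = y.
Proof.
pose h x := sval (cid (graph_closure_ex x)).
have hP x : graph_closure x (h x) := svalP (cid (graph_closure_ex x)).
have hE x y : graph_closure x y -> h x = y by exact: graph_closure_inj.
have hL : linear h by move=> a x y; apply: hE; exact: graph_closure_linear.
exists h; last by move=> x y /graph_closure_sub/hE.
split=> //.
- by move=> x y; apply: hE; exact: graph_closureM.
- by move=> x; apply: hE; exact: graph_closure_star.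
- apply: (bound_linear_continuous (k := 1)) => // x; rewrite mul1r.
  exact: graph_closure_le.
Qed.

End Graph_extension.

(** * Minimal tensor products *)

Section Tensor_algebra.
Variables (R : realType) (A B C : cstarType R) (t : A -> B -> C).
Hypothesis tP : is_min_tensor t.

Lemma tensM a a' b b' : t a b ** t a' b' = t (a ** a') (b ** b').
Proof. by have [_ _ -> _ _] := tP. Qed.
Lemma tensS a b : star (t a b) = t (star a) (star b).
Proof. by have [_ _ _ -> _] := tP. Qed.
Lemma tensDl a a' b : t (a + a') b = t a b + t a' b.
Proof. by have [h _ _ _ _] := tP; have := h b 1 a a'; rewrite !scale1r. Qed.
Lemma tensDr a b b' : t a (b + b') = t a b + t a b'.
Proof. by have [_ h _ _ _] := tP; have := h a 1 b b'; rewrite !scale1r. Qed.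
Lemma tens0l b : t 0 b = 0.
Proof. by apply: (@addrI _ (t 0 b)); rewrite -tensDl !addr0. Qed.
Lemma tens0r a : t a 0 = 0.
Proof. by apply: (@addrI _ (t a 0)); rewrite -tensDr !addr0. Qed.
Lemma tensZl c a b : t (c *: a) b = c *: t a b.
Proof.
by have [h _ _ _ _] := tP; have := h b c a 0; rewrite !addr0 tens0l addr0.
Qed.
Lemma tens_suml (I : Type) (r : seq I) (P : pred I) (F : I -> A) b :
  t (\sum_(i <- r | P i) F i) b = \sum_(i <- r | P i) t (F i) b.
Proof.
exact: (big_morph (fun a => t a b) (fun a a' => tensDl a a' b) (tens0l b)).
Qed.
Lemma tens_sumr (I : Type) (r : seq I) (P : pred I) (F : I -> B) a :
  t a (\sum_(i <- r | P i) F i) = \sum_(i <- r | P i) t a (F i).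
Proof. exact: (big_morph (t a) (tensDr a) (tens0r a)). Qed.

Lemma tens_norm_le n (a : 'I_n -> A) (b : 'I_n -> B) (c : R[i]) : 0 <= c ->
  `|\sum_i t (a i) (b i)| <= c <-> spatial_norm_le a b c.
Proof. by have [_ _ _ _ [_ h]] := tP; exact: h. Qed.

Lemma tens_dense x :
  approx [set y | exists l : seq (A * B), y = \sum_(ab <- l) t ab.1 ab.2] x.
Proof.
have [_ _ _ _ [/denseP h _]] := tP => eps /(h x)[_ [n [a [b ->]]] xy].
exists (\sum_i t (a i) (b i)) => //.
by exists [seq (a i, b i) | i : 'I_n]; rewrite big_image.
Qed.

End Tensor_algebra.

Section Tensor_of_homs.
Variables (R : realType) (A B C A' B' C' : cstarType R).
Variables (t : A -> B -> C) (t' : A' -> B' -> C').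
Hypotheses (tP : is_min_tensor t) (t'P : is_min_tensor t').

Lemma is_rep_comp (D D' : cstarType R) (phi : D -> D') (H : hilbertType R)
    (pi : D' -> H -> H) :
  star_hom phi -> is_rep pi -> is_rep (fun a => pi (phi a)).
Proof.
move=> [phiL phiM phiS phiC] [piL1 piL2 piM piS [M hM]].
have [k k0 hk] := continuous_linear_bound phiL phiC.
split=> //.
- by move=> xi a x y; rewrite phiL piL2.
- by move=> a b xi; rewrite phiM piM.
- by move=> a xi eta; rewrite piS phiS.
- exists (`|M| * k) => a xi.
  have M1 : `|pi (phi a) xi| <= `|M| * (`|phi a| * `|xi|).
    have := hM (phi a) xi; rewrite -mulrA => h.
    rewrite -[X in _ * X]ger0_norm ?mulr_ge0// -normrM ger0_norm//.
    exact: le_trans h.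
  rewrite (le_trans M1)// -!mulrA ler_wpM2l// mulrA ler_wpM2r//.
Qed.

(** The spatial norm is a supremum over representations; composing them with
    [phi] and [psi] gives representations of [A] and [B], so [phi (x) psi] does not
    increase it. *)
Lemma star_hom_tensor (phi : A -> A') (psi : B -> B') :
  star_hom phi -> star_hom psi ->
  exists2 h : C -> C', star_hom h & forall a b, h (t a b) = t' (phi a) (psi b).
Proof.
move=> phiP psiP.
have [phiL phiM phiS _] := phiP; have [psiL psiM psiS _] := psiP.
have phiZ := scalable_linear phiL.
pose Gr x y := exists l : seq (A * B), x = \sum_(ab <- l) t ab.1 ab.2 /\
  y = \sum_(ab <- l) t' (phi ab.1) (psi ab.2).
have [|||||h hP hE] := @star_hom_of_graph R C C' Gr.
- move=> c _ _ _ _ [l [-> ->]] [l' [-> ->]].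
  exists ([seq (c *: ab.1, ab.2) | ab <- l] ++ l').
  rewrite !big_cat !big_map !scaler_sumr; split; congr (_ + _).
    by apply: eq_bigr => ab _; rewrite (tensZl tP).
  by apply: eq_bigr => ab _; rewrite phiZ (tensZl t'P).
- move=> _ _ _ _ [l [-> ->]] [l' [-> ->]].
  exists [seq (ab.1 ** ab'.1, ab.2 ** ab'.2) | ab <- l, ab' <- l'].
  rewrite !big_allpairs_dep !cmul_suml; split; apply: eq_bigr => ab _.
    by rewrite cmul_sumr; apply: eq_bigr => ab' _; rewrite (tensM tP).
  rewrite cmul_sumr; apply: eq_bigr => ab' _.
  by rewrite (tensM t'P) phiM psiM.
- move=> _ _ [l [-> ->]]; exists [seq (star ab.1, star ab.2) | ab <- l].
  rewrite !big_map !star_sum; split; apply: eq_bigr => ab _.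
    by rewrite (tensS tP).
  by rewrite (tensS t'P) phiS psiS.
- move=> _ _ [l [-> ->]].
  rewrite !(big_nth (0, 0)) !big_mkord.
  pose a (i : 'I_(size l)) := (nth (0, 0) l i).1.
  pose b (i : 'I_(size l)) := (nth (0, 0) l i).2.
  apply: (proj2 (tens_norm_le t'P (phi \o a) (psi \o b) _)) => //.
  have h := proj1 (tens_norm_le tP a b (normr_ge0 _)) (lexx _).
  move=> H1 H2 pi rho piP rhoP.
  exact: (h H1 H2 _ _ (is_rep_comp phiP piP) (is_rep_comp psiP rhoP)).
- apply/denseP => x eps /(tens_dense tP x)[_ [l ->] xl].
  exists (\sum_(ab <- l) t ab.1 ab.2) => //.
  by exists (\sum_(ab <- l) t' (phi ab.1) (psi ab.2)), l.
exists h => // a b; apply: hE; exists [:: (a, b)].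
by rewrite !big_seq1.
Qed.

End Tensor_of_homs.

(** * Continuity of elementary tensors in one variable *)

Section Hilbert.
Variables (R : realType) (H : hilbertType R).
Implicit Types x y z : H.

Lemma dotBl x y z : dot (x - y) z = dot x z - dot y z.
Proof. by rewrite dotDl -scaleN1r dotZl mulN1r. Qed.
Lemma dotBr x y z : dot x (y - z) = dot x y - dot x z.
Proof. by rewrite dotC dotBl rmorphB /= -!dotC. Qed.
Lemma dotZr (c : R[i]) x y : dot x (c *: y) = Num.conj c * dot x y.
Proof. by rewrite dotC dotZl rmorphM /= -dotC. Qed.

Lemma dot_cauchy_schwarz x y : `|dot x y| <= `|x| * `|y|.
Proof.
have [->|y0] := eqVneq y 0.
  by rewrite -(scale0r 0) dotZr rmorph0 mul0r normr0 scale0r normr0 mulr0.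
have yy0 : 0 < `|y| ^+ 2 by rewrite exprn_gt0// normr_gt0.
rewrite -(@ler_pXn2r _ 2) ?nnegrE ?mulr_ge0// exprMn -ler_pdivrMr//.
rewrite -subr_ge0; pose c : R[i] := dot x y / `|y| ^+ 2.
suff -> : `|x| ^+ 2 - `|dot x y| ^+ 2 / `|y| ^+ 2 = `|x - c *: y| ^+ 2.
  by rewrite exprn_ge0.
have nE : Num.conj (`|y| ^+ 2 : R[i]) = `|y| ^+ 2.
  by apply: conj_Creal; rewrite realX// normr_real.
have cE : Num.conj c = Num.conj (dot x y) / `|y| ^+ 2.
  by rewrite -[in RHS]nE /c rmorphM /= fmorphV.
rewrite !(dot_norm (x - _)) dotBl !dotBr !dotZl !dotZr -!dot_norm normCK cE.
rewrite (dotC x y) /c mulfVK ?gt_eqF//.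
by rewrite subrr subr0 [_ / _ * dot x y]mulrC mulrA.
Qed.
End Hilbert.

(** Each condition in the definition of the spatial norm bounds a continuous
    function of [a'], so the set of [a'] satisfying all of them is closed.  The
    constant [L] of continuity depends on the representations and the vectors. *)
Lemma approx_tens_ball (R : realType) (A B C : cstarType R) (t : A -> B -> C)
    (a : A) (b : B) (c : R[i]) : is_min_tensor t -> 0 <= c ->
  approx [set a' | `|t a' b| <= c] a -> `|t a b| <= c.
Proof.
move=> tP c0 ha.
have ball x : `|t x b| <= c <-> spatial_norm_le (fun _ : 'I_1 => x) (fun=> b) c.
  by rewrite -(tens_norm_le tP)// big_ord1.
apply/ball => H1 H2 pi rho piP rhoP m xi eta.
pose N x := tensor_sqnorm (fun ij : 'I_1 * 'I_m => pi x (xi ij.2))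
                (fun ij : 'I_1 * 'I_m => rho b (eta ij.2)).
rewrite -/(N a); pose K : R[i] := c ^+ 2 * tensor_sqnorm xi eta; rewrite -/K.
have {}ha : approx [set x | N x <= K] a.
  by move=> eps /ha[x /ball xb ax]; exists x => //; exact: xb.
have [piL1 piL2 _ _ [M0 hM0]] := piP.
pose M : R[i] := `|M0|; have Mge0 : 0 <= M by exact: normr_ge0.
have piB d z : `|pi d z| <= M * `|d| * `|z|.
  have M00 := le_trans (normr_ge0 _) (hM0 d z).
  by rewrite -[leRHS]mulrA -[_ * `|z|]ger0_norm ?mulr_ge0// -normrM mulrA ger0_norm.
have {}piB d z : `|pi d z| <= `|d| * (M * `|z|) by rewrite mulrCA mulrA.
have piBB x y z : pi (x - y) z = pi x z - pi y z.
  exact: (zmod_morphism_linear (piL2 z)).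
pose L : R[i] := \sum_(i : 'I_1 * 'I_m) \sum_(j : 'I_1 * 'I_m)
  (M * `|xi i.2| * (M * `|xi j.2|) * (`|a| + (`|a| + 1))) *
    `|dot (rho b (eta i.2)) (rho b (eta j.2))|.
have NL x : `|a - x| <= 1 -> `|N a - N x| <= L * `|a - x|.
  move=> ax1.
  have x1 : `|x| <= `|a| + 1.
    by rewrite -[x](subKr a) (le_trans (ler_normB _ _))// lerD2l.
  rewrite /N /tensor_sqnorm -sumrB mulr_suml (le_trans (ler_norm_sum _ _ _))//.
  apply: ler_sum => i _; rewrite -sumrB mulr_suml (le_trans (ler_norm_sum _ _ _))//.
  apply: ler_sum => j _; rewrite -mulrBl normrM mulrAC ler_wpM2r//.
  have -> : dot (pi a (xi i.2)) (pi a (xi j.2)) - dot (pi x (xi i.2)) (pi x (xi j.2))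
    = dot (pi (a - x) (xi i.2)) (pi a (xi j.2))
      + dot (pi x (xi i.2)) (pi (a - x) (xi j.2)).
    by rewrite !piBB dotBl dotBr addrA addrNK.
  rewrite (le_trans (ler_normD _ _))// mulrDr mulrDl lerD//.
    rewrite (le_trans (dot_cauchy_schwarz _ _))//.
    rewrite (le_trans (ler_pM _ _ (piB _ _) (piB _ _)))//.
    by rewrite le_eqVlt; apply/orP; left; apply/eqP; ring.
  rewrite (le_trans (dot_cauchy_schwarz _ _))//.
  rewrite (le_trans (ler_pM _ _ (piB _ _) (piB _ _)))//.
  have -> : `|x| * (M * `|xi i.2|) * (`|a - x| * (M * `|xi j.2|)) =
    (M * `|xi i.2| * (M * `|xi j.2|) * `|a - x|) * `|x| by ring.
  by rewrite [leRHS]mulrAC ler_wpM2l// ?mulr_ge0.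
have L0 : 0 <= L.
  apply: sumr_ge0 => i _; apply: sumr_ge0 => j _.
  by rewrite !mulr_ge0// !addr_ge0.
(* In the partially ordered complex numbers, w >= 0 is the closed condition
   |w| = w. *)
suff e : `|K - N a| = K - N a by rewrite -subr_ge0 -e.
apply/eqP; rewrite -subr_eq0 -normr_eq0 eq_le normr_ge0 andbT.
rewrite real_leNgt ?normr_real//; apply/negP => w0.
set w := _ - _ in w0.
have L1 : 0 < L + 1 by rewrite ltr_wpDl.
have e0 : 0 < `|w| / 2 / (L + 1) by rewrite !divr_gt0.
have [e [epos el e1]] := pos_lower_bound e0 (@ltr01 R[i]).
have [x Nx ax] := ha e epos.
have h := NL x (ltW (lt_le_trans ax e1)).
suff : `|w| < `|w| by rewrite ltxx.
have wE : w = (`|K - N a| - `|K - N x|) + (N a - N x).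
  rewrite (ger0_norm (_ : 0 <= K - N x)) ?subr_ge0//.
  by rewrite /w; ring.
rewrite {1}wE (le_lt_trans (ler_normD _ _))//.
have h2 : Num.norm (`|K - N a| - `|K - N x|) <= L * `|a - x|.
  rewrite (le_trans (ler_dist_dist _ _))// (_ : _ - _ = - (N a - N x)); last by ring.
  by rewrite normrN.
rewrite (le_lt_trans (lerD h2 h))// [ltRHS]splitr.
suff : L * `|a - x| < `|w| / 2 by move=> hh; rewrite ltrD.
rewrite (@le_lt_trans _ _ (L * e))//; first by rewrite ler_wpM2l// ltW.
rewrite (@lt_le_trans _ _ ((L + 1) * e))//; first by rewrite ltr_pM2r// ltrDl.
by rewrite mulrC -ler_pdivlMr.
Qed.

(** On differences of points where [f] and [t _ b] agree, [t _ b] is bounded by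
    [f].  As the sets [`|t _ b| <= c] are closed, this bound persists at limits of
    such differences, and [t _ b] is continuous along the approximation. *)
Lemma approx_tens_leg (R : realType) (A B C : cstarType R) (t : A -> B -> C)
    (f : A -> C) (a : A) (b : B) : is_min_tensor t ->
  linear f -> continuous f ->
  approx [set a' | f a' = t a' b] a -> f a = t a b.
Proof.
move=> tP fL fC ha; have [k k0 fk] := continuous_linear_bound fL fC.
have fB := zmod_morphism_linear fL.
have tB x y : t (x - y) b = t x b - t y b.
  by rewrite (tensDl tP) -scaleN1r (tensZl tP) scaleN1r.
apply/eqP; rewrite -subr_eq0 -normr_eq0 eq_le normr_ge0 andbT.
rewrite real_leNgt ?normr_real//; apply/negP => w0.
set w := f a - t a b in w0.
pose d := `|w| / (4%:R * k).
have d0 : 0 < d by rewrite divr_gt0// mulr_gt0.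
have [a0 fa0 aa0] := ha d d0.
have h1 : `|f (a - a0)| <= k * d by rewrite (le_trans (fk _))// ler_wpM2l ?ltW.
have h2 : `|t (a - a0) b| <= k * (d + d).
  apply: (approx_tens_ball tP); first by rewrite mulr_ge0 ?addr_ge0 ?ltW.
  move=> eps eps0; have [e [e0 ee ed]] := pos_lower_bound eps0 d0.
  have [a1 fa1 aa1] := ha e e0.
  exists (a1 - a0) => /=.
    rewrite tB -fa0 -fa1 -fB (le_trans (fk _))// ler_wpM2l ?(ltW k0)//.
    rewrite -(subrKA a) (le_trans (ler_normD _ _))// lerD//; last exact: ltW.
    by rewrite distrC ltW// (lt_le_trans aa1).
  by rewrite opprB addrA addrNK (lt_le_trans aa1).
suff : `|w| < `|w| by rewrite ltxx.
have wE : w = f (a - a0) - t (a - a0) b.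
  by rewrite tB fB fa0 opprB addrA addrNK.
rewrite {1}wE (le_lt_trans (ler_normB _ _))// (le_lt_trans (lerD h1 h2))//.
have -> : `|w| = k * d + k * (d + d) + k * d.
  by rewrite /d; field; rewrite gt_eqF.
by rewrite ltrDl mulr_gt0.
Qed.

(** * Magic matrices *)

(** With [W] the diagonal matrix of [w], the invariance [q_w] of the weight says
    [q^* W q = W], so [W^-1 q^* W] is a left inverse of [q].  The idempotent
    [e = q W^-1 q^* W] fixes the range of [q]; the range being dense, [e = 1], and
    the entries of [e] give the relations along the columns. *)
Section Magic.
Variables (R : realType) (Q : cstarType R) (one : Q) (X : finType).
Hypothesis oneP : is_unit one.
Variables (q : X -> X -> Q) (w : X -> R[i]).
Hypothesis q_proj : forall k j, is_proj (q k j).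
Hypothesis q_row : forall k i j, i != j -> q k i ** q k j = 0.
Hypothesis w_neq0 : forall k, w k != 0.
Hypothesis q_w : forall j, \sum_k w k *: q k j = w j *: one.
Hypothesis q_dense : forall (F : X -> Q) (eps : R[i]), 0 < eps ->
  exists a : X -> Q, forall k, `|F k - \sum_j q k j ** a j| < eps.

Let mulx1 x : x ** one = x. Proof. by case: (oneP x). Qed.

Let e k l := \sum_j (w l / w j) *: (q k j ** q l j).

Let e_q k i : \sum_l e k l ** q l i = q k i.
Proof.
transitivity (\sum_l (w l / w i) *: (q k i ** q l i)).
  apply: eq_bigr => l _; rewrite cmul_suml (bigD1 i)//= big1 ?addr0.
    by rewrite cmulZl -cmulA; have [_ ->] := q_proj l i.
  by move=> j ji; rewrite cmulZl -cmulA q_row// cmulx0 scaler0.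
rewrite -[RHS]mulx1 -[one](scalerK (w_neq0 i)) -q_w cmulZr cmul_sumr scaler_sumr.
by apply: eq_bigr => l _; rewrite cmulZr scalerA mulrC.
Qed.

Let e_fix (F : X -> Q) k : \sum_l e k l ** F l = F k.
Proof.
apply/eqP; rewrite -subr_eq0; apply/eqP; apply: norm_arbitrarily_small_eq0.
move=> eps eps0; pose c := \sum_l `|e k l| + 1.
have c0 : 0 < c by rewrite ltr_wpDl// sumr_ge0.
have [a ha] := q_dense F (divr_gt0 eps0 c0).
pose H l := \sum_j q l j ** a j.
have eH : \sum_l e k l ** H l = H k.
  under eq_bigr do rewrite cmul_sumr.
  rewrite exchange_big; apply: eq_bigr => j _ /=.
  by rewrite -[in RHS]e_q cmul_suml; apply: eq_bigr => l _; rewrite cmulA.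
have -> : \sum_l e k l ** F l - F k = \sum_l e k l ** (F l - H l) - (F k - H k).
  under [in RHS]eq_bigr do rewrite cmulBr.
  by rewrite sumrB eH opprB addrA addrNK.
rewrite (le_trans (ler_normB _ _))// -[leRHS](divfK (lt0r_neq0 c0)) mulrC.
rewrite mulrDl mul1r lerD//; last exact: ltW.
rewrite mulr_suml (le_trans (ler_norm_sum _ _ _))// ler_sum// => l _.
by rewrite (le_trans (cnormM _ _))// ler_wpM2l// ltW.
Qed.

Let eE k m : e k m = if k == m then one else 0.
Proof.
have <- := e_fix (fun l => if l == m then one else 0) k.
rewrite (bigD1 m)//= eqxx mulx1 big1 ?addr0// => l /negPf ->.
by rewrite cmulx0.
Qed.

Let q_e i k m : q k i ** e k m = (w m / w i) *: (q k i ** q m i).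
Proof.
rewrite cmul_sumr (bigD1 i)//= big1 ?addr0.
  by rewrite cmulZr cmulA; have [_ ->] := q_proj k i.
by move=> j ji; rewrite cmulZr cmulA q_row 1?eq_sym// cmul0x scaler0.
Qed.

Lemma magic_col i k m : k != m -> q k i ** q m i = 0.
Proof.
move=> km; have /eqP := q_e i k m; rewrite eE (negPf km) cmulx0 eq_sym.
rewrite scaler_eq0 mulf_eq0 invr_eq0 (negPf (w_neq0 _)) (negPf (w_neq0 _)) /=.
by move/eqP.
Qed.

Lemma magic_col_sum i : \sum_k q k i = one.
Proof.
apply: (scalerI (w_neq0 i)); rewrite -q_w scaler_sumr; apply: eq_bigr => k _.
have := q_e i k k; rewrite eE eqxx mulx1; have [_ ->] := q_proj k i.
by move=> {1}->; rewrite scalerA mulrC divfK.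
Qed.

End Magic.

(** * Co-actions on functions *)

Lemma big_sig (V : nmodType) (T : finType) (W : pred T) (F : T -> V) :
  \sum_(x : {x | W x}) F (val x) = \sum_(x | W x) F x.
Proof.
rewrite [RHS](reindex_omap (val : {x | W x} -> T) insub).
  by apply: eq_bigl => -[x Wx] /=; rewrite insubT Wx /= eqxx.
by move=> x Wx; rewrite insubT.
Qed.

Section Function_coactions.
Variables (R : realType) (Q : compact_quantum_group R).

Lemma linear_chi (X : finType) (a : {ffun X -> R[i]} -> {ffun X -> Q}) f x :
  linear a -> a f x = \sum_j f j *: a (chi R j) x.
Proof.
move=> aL; pose g := GRing.isLinear.Build R[i] _ _ *:%R a aL.
pose h : {linear {ffun X -> R[i]} -> {ffun X -> Q}} := HB.pack a g.
have fE : f = \sum_j f j *: chi R j.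
  apply/ffunP => y; rewrite sum_ffunE (bigD1 y)//= !ffunE eqxx big1 ?addr0.
    by rewrite [RHS]mulr1.
  by move=> j jy; rewrite !ffunE eq_sym (negPf jy) scaler0.
rewrite {1}fE -[a]/(h : _ -> _) linear_sum sum_ffunE; apply: eq_bigr => j _.
by rewrite linearZ ffunE.
Qed.

Variables (G : multigraph) (W : pred (vert G)).
Let V := vert G.
Let X : finType := {v | W v}.
Variable a0 : {ffun X -> R[i]} -> {ffun X -> Q}.
Hypothesis a0P : is_fun_coaction a0.

Let q (k j : X) : Q := coef a0 k j.

Lemma fun_coaction_proj k j : is_proj (q k j).
Proof.
have [_ aM aS _ _] := a0P; split.
  rewrite /q /coef -aS; congr (a0 _ _); apply/ffunP => y; rewrite !ffunE.
  exact: conjC_nat.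
rewrite /q /coef -aM; congr (a0 _ _); apply/ffunP => y; rewrite !ffunE.
by case: eqP; rewrite ?mulr1 ?mulr0.
Qed.

Lemma fun_coaction_row k i j : i != j -> q k i ** q k j = 0.
Proof.
have [aL aM _ _ _] := a0P => ij.
rewrite /q /coef -aM linear_chi// big1// => y _.
rewrite !ffunE; case: (eqVneq y i) => [->|_]; last by rewrite mul0r scale0r.
by rewrite (negPf ij) mulr0 scale0r.
Qed.

Lemma fun_coaction_row_sum k : \sum_j q k j = cqg_one Q.
Proof.
have [aL _ _ a1 _] := a0P; rewrite -(a1 k) linear_chi//.
by apply: eq_bigr => j _; rewrite ffunE scale1r.
Qed.

Lemma fun_coaction_dense (F : X -> Q) (eps : R[i]) : 0 < eps ->
  exists a : X -> Q, forall k, `|F k - \sum_j q k j ** a j| < eps.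
Proof.
have [aL _ _ _ [_ d]] := a0P => /(d [ffun x => F x])[n [f [a h]]].
exists (fun j => \sum_i f i j *: a i) => k; have := h k; rewrite ffunE.
suff -> : \sum_j q k j ** (\sum_i f i j *: a i) = \sum_i a0 (f i) k ** a i by [].
under [RHS]eq_bigr => i _ do rewrite linear_chi// cmul_suml.
rewrite exchange_big; apply: eq_bigr => j _; rewrite cmul_sumr.
by apply: eq_bigr => i _; rewrite cmulZr cmulZl.
Qed.

Lemma coef_ext0 (a : {ffun V -> R[i]} -> {ffun V -> Q}) :
  (forall i : X, a (chi R (val i)) = ext0 (a0 (chi R i))) ->
  (forall k i : X, coef a (val k) (val i) = q k i) /\
  (forall k (i : X), ~~ W k -> coef a k (val i) = 0).
Proof.
move=> h; split=> k i; rewrite /coef h ffunE.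
  by rewrite valK.
by move=> /negPf Wk; rewrite insubF.
Qed.

End Function_coactions.

(** * The matrices of a co-action on a multigraph *)

Section Banica_relations.
Variables (R : realType) (Q : compact_quantum_group R) (G : multigraph).
Local Notation E := (edge G).
Local Notation V := (vert G).
Variable beta : {ffun E -> R[i]} -> {ffun E -> Q}.
Variable alpha : {ffun V -> R[i]} -> {ffun V -> Q}.
Variable alpha_s : {ffun Vs G -> R[i]} -> {ffun Vs G -> Q}.
Variable alpha_t : {ffun Vt G -> R[i]} -> {ffun Vt G -> Q}.
Hypothesis betaL : linear beta.
Hypothesis beta_unitary : is_biunitary beta.
Hypothesis alpha_sP : induced_src beta alpha_s.
Hypothesis alpha_tP : induced_tgt beta alpha_t.
Hypothesis alpha_sE : forall i : Vs G,
  alpha (chi R (val i)) = ext0 (alpha_s (chi R i)).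
Hypothesis alpha_tE : forall j : Vt G,
  alpha (chi R (val j)) = ext0 (alpha_t (chi R j)).

Let u := coef beta.
Let q := coef alpha.
Let one := cqg_one Q.
Implicit Types (i j k l : V) (x y z e : E).
Let oneP : is_unit one := @cqg_oneP _ Q.

Lemma cqg_mul1x (x : Q) : one ** x = x. Proof. by case: (oneP x). Qed.
Lemma cqg_mulx1 (x : Q) : x ** one = x. Proof. by case: (oneP x). Qed.

Lemma unitary_rows x y : \sum_z u x z ** star (u y z) = if x == y then one else 0.
Proof.
have [[h _] _] := beta_unitary; move: (congr1 (fun f => f x y) h).
rewrite /mxmulQ /mxadjQ /mxoneQ /mxscalQ => ->.
by case: eqP; rewrite ?scale1r ?scale0r.
Qed.

Lemma unitary_cols x y : \sum_z star (u z x) ** u z y = if x == y then one else 0.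
Proof.
have [[_ h] _] := beta_unitary; move: (congr1 (fun f => f x y) h).
rewrite /mxmulQ /mxadjQ /mxoneQ /mxscalQ => ->.
by case: eqP; rewrite ?scale1r ?scale0r.
Qed.

Lemma conj_unitary_rows x y :
  \sum_z star (u x z) ** u y z = if x == y then one else 0.
Proof.
have [_ [h _]] := beta_unitary; move: (congr1 (fun f => f x y) h).
rewrite /mxmulQ /mxadjQ /mxoneQ /mxscalQ /mxconjQ.
under eq_bigr do rewrite starK.
by move=> ->; case: eqP; rewrite ?scale1r ?scale0r.
Qed.

Lemma coef_src_eq0 i k : is_src i -> ~~ is_src k -> q k i = 0.
Proof. by move=> si nk; have [_ /(_ k (Sub i si) nk)] := coef_ext0 alpha_sE. Qed.
Lemma coef_tgt_eq0 i k : is_tgt i -> ~~ is_tgt k -> q k i = 0.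
Proof. by move=> ti nk; have [_ /(_ k (Sub i ti) nk)] := coef_ext0 alpha_tE. Qed.

Lemma coef_srcE k i (sk : is_src k) (si : is_src i) :
  q k i = coef alpha_s (Sub k sk) (Sub i si).
Proof. by have [<- _] := coef_ext0 alpha_sE. Qed.
Lemma coef_tgtE k i (tk : is_tgt k) (ti : is_tgt i) :
  q k i = coef alpha_t (Sub k tk) (Sub i ti).
Proof. by have [<- _] := coef_ext0 alpha_tE. Qed.

Hypothesis hG : no_isolated G.

Lemma src_or_tgt (v : V) : is_src v \/ is_tgt v.
Proof.
have [e [<-|<-]] := hG v; [left; exact: is_src_src | right; exact: is_tgt_tgt].
Qed.

Lemma not_src_is_tgt (v : V) : ~~ is_src v -> is_tgt v.
Proof. by move=> /negP nsv; case: (src_or_tgt v). Qed.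

Lemma coef_proj k i : is_proj (q k i).
Proof.
have [si|ti] := src_or_tgt i.
  have [sk|nsk] := boolP (is_src k); last by rewrite coef_src_eq0//; exact: is_proj0.
  by rewrite (coef_srcE sk si); apply: fun_coaction_proj; case: alpha_sP.
have [tk|ntk] := boolP (is_tgt k); last by rewrite coef_tgt_eq0//; exact: is_proj0.
by rewrite (coef_tgtE tk ti); apply: fun_coaction_proj; case: alpha_tP.
Qed.

Lemma coef_src_row k i j : is_src i -> is_src j -> i != j -> q k i ** q k j = 0.
Proof.
move=> si sj ij; have [sk|nsk] := boolP (is_src k); last first.
  by rewrite coef_src_eq0// cmul0x.
rewrite (coef_srcE sk si) (coef_srcE sk sj); apply: fun_coaction_row.
  by case: alpha_sP.
by rewrite -val_eqE.
Qed.

Lemma coef_tgt_row k i j : is_tgt i -> is_tgt j -> i != j -> q k i ** q k j = 0.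
Proof.
move=> si sj ij; have [sk|nsk] := boolP (is_tgt k); last first.
  by rewrite coef_tgt_eq0// cmul0x.
rewrite (coef_tgtE sk si) (coef_tgtE sk sj); apply: fun_coaction_row.
  by case: alpha_tP.
by rewrite -val_eqE.
Qed.

Lemma coef_src_row_sum k : is_src k -> \sum_(i | is_src i) q k i = one.
Proof.
move=> sk; have [h _] := alpha_sP; rewrite /one -(fun_coaction_row_sum h (Sub k sk)).
rewrite -big_sig; apply: eq_bigr => -[i si] _.
by rewrite (coef_srcE sk (valP (exist _ i si))); congr (coef _ _ _); exact: val_inj.
Qed.
Lemma coef_tgt_row_sum k : is_tgt k -> \sum_(i | is_tgt i) q k i = one.
Proof.
move=> sk; have [h _] := alpha_tP; rewrite /one -(fun_coaction_row_sum h (Sub k sk)).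
rewrite -big_sig; apply: eq_bigr => -[i si] _.
by rewrite (coef_tgtE sk (valP (exist _ i si))); congr (coef _ _ _); exact: val_inj.
Qed.

Lemma coef_src_edge i s t : is_src i ->
  q (src s) i ** u s t = if i == src t then u s t else 0.
Proof.
move=> si; have [_ h] := alpha_sP.
have := congr1 (fun f : {ffun E -> Q} => f s) (h (Sub i si) t).
rewrite ffunE (coef_srcE (is_src_src s) si) -[beta _ s]/(u s t) => ->.
have -> : lact (chi R (Sub i si : Vs G)) (chi R t) = (i == src t)%:R *: chi R t.
  apply/ffunP => e; rewrite !ffunE -val_eqE /=.
  case: (eqVneq e t) => [->|_]; last by rewrite mulr0 scaler0.
  by rewrite eq_sym [RHS]mulr1 mulr1.
by rewrite (scalable_linear betaL) ffunE; case: eqP; rewrite ?scale1r ?scale0r.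
Qed.

Lemma coef_tgt_edge j s t : is_tgt j ->
  u s t ** q (tgt s) j = if j == tgt t then u s t else 0.
Proof.
move=> si; have [_ h] := alpha_tP.
have := congr1 (fun f : {ffun E -> Q} => f s) (h (Sub j si) t).
rewrite ffunE (coef_tgtE (is_tgt_tgt s) si) -[beta _ s]/(u s t) => ->.
have -> : ract (chi R t) (chi R (Sub j si : Vt G)) = (j == tgt t)%:R *: chi R t.
  apply/ffunP => e; rewrite !ffunE -val_eqE /=.
  case: (eqVneq e t) => [->|_]; last by rewrite mul0r scaler0.
  by rewrite eq_sym mul1r [RHS]mulr1.
by rewrite (scalable_linear betaL) ffunE; case: eqP; rewrite ?scale1r ?scale0r.
Qed.

(** The covariance of [beta] inserts [q (src x) i] in front of [u x z], which
    cuts the sum over all [z] down to [src z = i]. *)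
Lemma edge_rows_src i x y : is_src i ->
  \sum_(z | src z == i) u x z ** star (u y z) = if x == y then q (src x) i else 0.
Proof.
move=> si; transitivity (q (src x) i ** (\sum_z u x z ** star (u y z))).
  rewrite big_mkcond cmul_sumr; apply: eq_bigr => z _.
  by rewrite cmulA coef_src_edge// eq_sym; case: eqP; rewrite ?cmul0x.
by rewrite unitary_rows; case: eqP; rewrite ?cqg_mulx1 ?cmulx0.
Qed.

Lemma edge_rows_tgt j x y : is_tgt j ->
  \sum_(z | tgt z == j) star (u x z) ** u y z = if x == y then q (tgt y) j else 0.
Proof.
move=> tj; transitivity ((\sum_z star (u x z) ** u y z) ** q (tgt y) j).
  rewrite big_mkcond cmul_suml; apply: eq_bigr => z _.
  by rewrite -cmulA coef_tgt_edge// eq_sym; case: eqP; rewrite ?cmulx0.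
by rewrite conj_unitary_rows; case: eqP; rewrite ?cqg_mul1x ?cmul0x.
Qed.

(** The in-degree.  Summing the diagonal of [edge_rows_tgt] over [x] and
    exchanging the sums shows that it is invariant under [q]. *)
Let in_deg (j : Vt G) : R[i] := #|[pred e | tgtV e == j]|%:R.

Let in_deg_neq0 (j : Vt G) : in_deg j != 0.
Proof.
rewrite pnatr_eq0 -lt0n; apply/card_gt0P.
have /existsP[e /eqP te] := valP j; exists e.
by rewrite inE -val_eqE /= te.
Qed.

Let in_deg_invariant (j : Vt G) :
  \sum_(k : Vt G) in_deg k *: q (val k) (val j) = in_deg j *: one.
Proof.
transitivity (\sum_e q (tgt e) (val j)).
  rewrite (partition_big (@tgtV G) predT)//=; apply: eq_bigr => k _.
  rewrite (eq_bigr (fun=> q (val k) (val j))) => [|e /eqP <- //].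
  by rewrite sumr_const scaler_nat.
transitivity (\sum_e \sum_(z | tgt z == val j) star (u e z) ** u e z).
  by apply: eq_bigr => e _; rewrite edge_rows_tgt ?eqxx//; exact: valP.
rewrite exchange_big /=.
rewrite (eq_bigr (fun=> one)) => [|z _]; last by rewrite unitary_cols eqxx.
by rewrite sumr_const scaler_nat.
Qed.

Lemma coef_tgt_col j k l : is_tgt j -> is_tgt k -> is_tgt l -> k != l ->
  q k j ** q l j = 0.
Proof.
move=> tj tk tl kl; have [h _] := alpha_tP.
have [ext _] := coef_ext0 alpha_tE.
have col := @magic_col R Q one (Vt G) oneP
  (fun k j : Vt G => q (val k) (val j)) in_deg.
apply: (col _ _ _ _ _ (Sub j tj) (Sub k tk) (Sub l tl)) => //.
- by move=> ? ?; exact: coef_proj.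
- by move=> k' i' j' ?; apply: coef_tgt_row; [exact: valP..|].
- move=> F eps /(fun_coaction_dense h F)[a ha]; exists a => k'.
  rewrite (eq_bigr (fun j' : Vt G => coef alpha_t k' j' ** a j')) => [|j' _].
    exact: ha.
  by rewrite /q ext.
Qed.

Lemma coef_tgt_col_sum j : is_tgt j -> \sum_(k | is_tgt k) q k j = one.
Proof.
move=> tj; have [h _] := alpha_tP.
have [ext _] := coef_ext0 alpha_tE.
have col := @magic_col_sum R Q one (Vt G) oneP
  (fun k j : Vt G => q (val k) (val j)) in_deg.
rewrite -(col _ _ _ _ _ (Sub j tj)) => //.
- by rewrite -big_sig.
- by move=> ? ?; exact: coef_proj.
- by move=> k' i' j' ?; apply: coef_tgt_row; [exact: valP..|].
- move=> F eps /(fun_coaction_dense h F)[a ha]; exists a => k'.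
  rewrite (eq_bigr (fun j' : Vt G => coef alpha_t k' j' ** a j')) => [|j' _].
    exact: ha.
  by rewrite /q ext.
Qed.

(** Multiplying the unitarity relation [\sum_x (u x z)^* u x z = 1] on the right by
    [q k (tgt z)] keeps the terms with [tgt x = k], by the orthogonality of
    the column of [q] indexed by [tgt z]. *)
Lemma edge_cols_tgt k z :
  \sum_(x | tgt x == k) star (u x z) ** u x z = q k (tgt z).
Proof.
have tz := is_tgt_tgt z.
have [tk|ntk] := boolP (is_tgt k); last first.
  rewrite coef_tgt_eq0// big1// => x /eqP tx.
  by move: ntk; rewrite -tx is_tgt_tgt.
transitivity ((\sum_x star (u x z) ** u x z) ** q k (tgt z)).
  rewrite big_mkcond cmul_suml; apply: eq_bigr => x _.
  have -> : u x z = u x z ** q (tgt x) (tgt z) by rewrite coef_tgt_edge// eqxx.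
  case: eqVneq => [<-|xk].
    rewrite -cmulA -[X in _ = _ ** X]cmulA.
    by have [_ ->] := coef_proj (tgt x) (tgt z).
  rewrite -cmulA -[X in _ = _ ** X]cmulA coef_tgt_col ?is_tgt_tgt//.
  by rewrite !cmulx0.
by rewrite unitary_cols eqxx cqg_mul1x.
Qed.

(** Let [I] be the set of vertices that are both sources and targets.  A column
    indexed by [I] vanishes outside the rows in [I], where its sum is 1; a row
    indexed by [I] has sum 1 over the target columns.  Hence the entries with row
    in [I] and column a target outside [I] have sum [#|I| - #|I| = 0], and
    projections of sum zero vanish. *)
Lemma coef_mixed_eq0 j k : is_tgt j -> ~~ is_src j -> is_src k -> q k j = 0.
Proof.
move=> tj nsj sk; have [tk|ntk] := boolP (is_tgt k); last exact: coef_tgt_eq0.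
pose I := [pred v : V | is_src v && is_tgt v].
pose B := [pred v : V | is_tgt v && ~~ is_src v].
pose qq (kj : V * V) := if I kj.1 && B kj.2 then q kj.1 kj.2 else 0.
have qqP kj : is_proj (qq kj).
  by rewrite /qq; case: ifP => _; [exact: coef_proj | exact: is_proj0].
have IE (F : V -> Q) : \sum_(v | is_tgt v && is_src v) F v = \sum_(v | I v) F v.
  by apply: eq_bigl => v; exact: andbC.
have sum0 : \sum_kj qq kj = 0.
  have -> : \sum_kj qq kj = \sum_(k' | I k') \sum_(j' | B j') q k' j'.
    by rewrite pair_big /= [RHS]big_mkcond.
  transitivity (\sum_(k' | I k') (one - \sum_(i | I i) q k' i)).
    apply: eq_bigr => k' /andP[_ tk']; rewrite -(coef_tgt_row_sum tk').
    by rewrite [in RHS](bigID (@is_src G))/= IE addrAC subrr add0r.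
  transitivity (\sum_(i | I i) (one - \sum_(k' | I k') q k' i)).
    by rewrite !sumrB; congr (_ - _); exact: exchange_big.
  apply: big1 => i /andP[si ti].
  rewrite -(coef_tgt_col_sum ti) (bigID (@is_src G))/= [X in _ + X - _]big1 => [|v].
    by rewrite addr0 IE subrr.
  by move=> /andP[_ nsv]; exact: coef_src_eq0.
have [] := proj_sum_absorb qqP (@is_proj0 R Q) sum0 (k, j).
by rewrite cmul0x /qq /= sk tk tj nsj /= => <-.
Qed.

Lemma coef_row k i j : i != j -> q k i ** q k j = 0.
Proof.
have mixed i' j' : is_src i' -> is_tgt j' -> ~~ is_src j' ->
    q k i' = 0 \/ q k j' = 0.
  move=> si tj nsj; have [sk|nsk] := boolP (is_src k).
    by right; exact: coef_mixed_eq0.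
  by left; exact: coef_src_eq0.
move=> ij; have [si|nsi] := boolP (is_src i); have [sj|nsj] := boolP (is_src j).
- exact: coef_src_row.
- by have [->|->] := mixed _ _ si (not_src_is_tgt nsj) nsj; rewrite ?cmul0x ?cmulx0.
- by have [->|->] := mixed _ _ sj (not_src_is_tgt nsi) nsi; rewrite ?cmul0x ?cmulx0.
- by apply: coef_tgt_row => //; exact: not_src_is_tgt.
Qed.

Lemma coef_row_sum k : \sum_i q k i = one.
Proof.
have [sk|nsk] := boolP (is_src k).
  rewrite (bigID (@is_src G))/= coef_src_row_sum// big1 ?addr0// => j nsj.
  by apply: coef_mixed_eq0 => //; exact: not_src_is_tgt.
have tk := not_src_is_tgt nsk.
rewrite (bigID (@is_tgt G))/= coef_tgt_row_sum// big1 ?addr0// => j ntj.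
by apply: coef_src_eq0 => //; case: (src_or_tgt j) => // tj; rewrite tj in ntj.
Qed.

(** * The transformed Cuntz-Krieger family *)

Section Transformed_family.
Variables (CG : cstarType R) (s : E -> CG) (p : V -> CG).
Hypothesis ckP : ck_family s p.
Variable CGQ : min_tensor CG Q.
Let t := @tens _ _ _ CGQ.
Let tP : is_min_tensor t := @tensP _ _ _ CGQ.

Definition coaction_edge e := \sum_x t (s x) (u x e).
Definition coaction_vert i := \sum_k t (p k) (q k i).
Local Notation S := coaction_edge.
Local Notation P := coaction_vert.

Lemma coaction_edge_star_mul e : star (S e) ** S e = P (tgt e).
Proof.
rewrite star_sum cmul_suml /P.
transitivity (\sum_x t (p (tgt x)) (star (u x e) ** u x e)).
  apply: eq_bigr => x _; rewrite cmul_sumr (bigD1 x)//= big1 ?addr0.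
    by rewrite (tensS tP) (tensM tP) (ck_starM ckP) eqxx.
  move=> y /negPf yx.
  by rewrite (tensS tP) (tensM tP) (ck_starM ckP) eq_sym yx (tens0l tP).
rewrite (partition_big (@tgt G) predT)//=; apply: eq_bigr => k _.
rewrite -edge_cols_tgt (tens_sumr tP); apply: eq_bigr => x /eqP <-.
by [].
Qed.

Lemma coaction_edge_vert e : S e ** P (tgt e) = S e.
Proof.
rewrite cmul_suml; apply: eq_bigr => x _; rewrite cmul_sumr (bigD1 (tgt x))//=.
rewrite big1 ?addr0 => [|k /negPf kx].
  by rewrite (tensM tP) (ck_sproj ckP) eqxx coef_tgt_edge ?is_tgt_tgt// eqxx.
by rewrite (tensM tP) (ck_sproj ckP) kx (tens0l tP).
Qed.

Lemma coaction_edge_sum v : is_src v ->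
  \sum_(e | src e == v) S e ** star (S e) = P v.
Proof.
have [_ _ _ _ sumE] := ckP => sv.
transitivity (\sum_x t (s x ** star (s x)) (q (src x) v)).
  transitivity (\sum_x \sum_y
      t (s x ** star (s y)) (\sum_(e | src e == v) u x e ** star (u y e))).
    under eq_bigr => e _ do rewrite star_sum cmul_suml.
    rewrite exchange_big; apply: eq_bigr => x _ /=.
    under eq_bigr => e _ do rewrite cmul_sumr.
    rewrite exchange_big; apply: eq_bigr => y _ /=.
    rewrite (tens_sumr tP); apply: eq_bigr => e _.
    by rewrite (tensS tP) (tensM tP).
  apply: eq_bigr => x _.
  rewrite (bigD1 x)//= [X in _ + X]big1 ?addr0 => [|y /negPf yx].
    by rewrite edge_rows_src// eqxx.
  by rewrite edge_rows_src// eq_sym yx (tens0r tP).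
rewrite (partition_big (@src G) predT)//=; apply: eq_bigr => k _.
rewrite (eq_bigr (fun x => t (s x ** star (s x)) (q k v))) => [|x /eqP <- //].
rewrite -(tens_suml tP); have [sk|nsk] := boolP (is_src k); first by rewrite sumE.
by rewrite coef_src_eq0// !(tens0r tP).
Qed.

Lemma coaction_ck_family : ck_family S P.
Proof.
split.
- by move=> e; rewrite -cmulA coaction_edge_star_mul coaction_edge_vert.
- move=> v; split.
    rewrite star_sum; apply: eq_bigr => k _; rewrite (tensS tP).
    by have [-> _] := ck_proj ckP k; have [-> _] := coef_proj k v.
  rewrite cmul_suml; apply: eq_bigr => k _.
  rewrite cmul_sumr (bigD1 k)//= big1 ?addr0 => [|l /negPf lk].
    rewrite (tensM tP).
    by have [_ ->] := ck_proj ckP k; have [_ ->] := coef_proj k v.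
  by rewrite (tensM tP) (ck_projM ckP) eq_sym lk (tens0l tP).
- move=> v w vw; rewrite cmul_suml big1// => k _.
  rewrite cmul_sumr big1// => l _; rewrite (tensM tP) (ck_projM ckP).
  case: eqVneq => [<-|_]; last exact: (tens0l tP).
  by rewrite coef_row// (tens0r tP).
- exact: coaction_edge_star_mul.
- exact: coaction_edge_sum.
Qed.

Lemma coaction_unit : \sum_v P v = t (ck_unit p) one.
Proof.
rewrite exchange_big (tens_suml tP); apply: eq_bigr => k _ /=.
by rewrite -(tens_sumr tP) coef_row_sum.
Qed.

End Transformed_family.

End Banica_relations.

(** * Homomorphisms from the graph algebra *)

Section Star_homs.
Variables (R : realType) (D D' : cstarType R).

Lemma star_hom_ext (S : set D) (f g : D -> D') : generates S ->
  star_hom f -> star_hom g -> (forall x, S x -> f x = g x) -> f =1 g.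
Proof.
move=> genS [fL fM fS fC] [gL gM gS gC] fg x.
suff : [set x | f x = g x] = setT by move=> e; have : setT x by []; rewrite -e.
apply: genS => //.
- by apply: approx_closed => {}x hx; exact: approx_equalizer.
- by move=> a y z /= fy fz; rewrite fL gL fy fz.
- by move=> y z /= fy fz; rewrite fM gM fy fz.
- by move=> y /= fy; rewrite fS gS fy.
Qed.

Lemma star_hom_sum (f : D -> D') (I : Type) (r : seq I) (W : pred I) (F : I -> D) :
  star_hom f -> f (\sum_(i <- r | W i) F i) = \sum_(i <- r | W i) f (F i).
Proof.
move=> [fL _ _ _]; apply: big_morph => [x y|].
  by have := fL 1 x y; rewrite !scale1r.
by have := zmod_morphism_linear fL 0 0; rewrite !subrr.
Qed.

End Star_homs.

Lemma star_hom_id (R : realType) (D : cstarType R) : star_hom (@id D).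
Proof. by split=> // x; exact: cvg_id. Qed.

Lemma star_hom_comp (R : realType) (D D' D'' : cstarType R)
    (g : D' -> D'') (f : D -> D') : star_hom g -> star_hom f -> star_hom (g \o f).
Proof.
move=> [gL gM gS gC] [fL fM fS fC]; split=> /=.
- by move=> a x y /=; rewrite fL gL.
- by move=> x y /=; rewrite fM gM.
- by move=> x /=; rewrite fS gS.
- by move=> x; apply: continuous_comp; [exact: fC | exact: gC].
Qed.

Section Generated_by_edges.
Variables (R : realType) (G : multigraph) (D : cstarType R).
Variables (s : edge G -> D) (p : vert G -> D).
Hypotheses (hG : no_isolated G) (ckP : ck_family s p).
Hypothesis gen : generates (range s `|` range p).

Lemma ck_edges_generate : generates (range s).
Proof.
move=> W Wc Ws WL WM WS; have [_ _ _ hs sumE] := ckP.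
have Wse e : W (s e) by apply: Ws; exists e.
apply: gen => // _ [[e _ <-]|[v _ <-]]//.
have [sv|nsv] := boolP (is_src v).
  have /existsP[e0 _] := sv.
  rewrite -sumE//; elim/big_ind : _ => [|x y Wx Wy|e _].
  - by have := WL (-1) _ _ (Wse e0) (Wse e0); rewrite scaleN1r addNr.
  - by have := WL 1 _ _ Wx Wy; rewrite scale1r.
  - by apply: WM => //; exact: WS.
have [e [sev|<-]] := hG v; first by rewrite -sev is_src_src in nsv.
by rewrite -hs; apply: WM => //; exact: WS.
Qed.

Lemma ck_is_unit : is_unit (ck_unit p).
Proof.
move=> x; have mulP (f : {linear D -> D}) :
    (forall z, `|f z| <= `|ck_unit p| * `|z|) ->
    forall y, approx [set z | f z = z] y -> f y = y.
  move=> fb y; apply: (@approx_equalizer _ _ _ f id) => //.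
  - exact: linearP.
  - exact: bound_linear_continuous (linearP f) _ fb.
  - by move=> z; exact: cvg_id.
suff : [set x | ck_unit p ** x = x /\ x ** ck_unit p = x] = setT.
  by move=> e; have : setT x by []; rewrite -e.
apply: ck_edges_generate.
- apply: approx_closed => y hy; split.
    apply: (mulP (cmul (ck_unit p))) => [z|]; first exact: cnormM.
    by move=> eps /hy[z [ez _] yz]; exists z.
  apply: (mulP (cmulr (ck_unit p))) => [z|]; first by rewrite mulrC; exact: cnormM.
  by move=> eps /hy[z [_ ez] yz]; exists z.
- by move=> _ [e _ <-]; exact: ck_unit_s.
- move=> a y z [ey ye] [ez ze]; split.
    by rewrite cmulDr cmulZr ey ez.
  by rewrite cmulDl cmulZl ye ze.
- by move=> y z [ey ye] [ez ze]; rewrite /= cmulA ey -cmulA ze.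
- move=> y [ey ye]; split; rewrite -{1}(ck_unit_star ckP) -starM ?ye ?ey//.
Qed.

End Generated_by_edges.

(** * Density of the co-action *)

Section Density.
Variables (R : realType) (Q : compact_quantum_group R) (D : cstarType R).
Variables (DQ : min_tensor D Q) (e : D) (a : D -> DQ).
Let t := @tens _ _ _ DQ.
Let tP : is_min_tensor t := @tensP _ _ _ DQ.
Let one := cqg_one Q.
Hypothesis eP : is_unit e.
Hypothesis aP : star_hom a.

Let D0 := [set x : DQ | exists l : seq (D * Q),
  x = \sum_(ba <- l) a ba.1 ** t e ba.2].
Let Y := approx D0.

Let D0_linear (c : R[i]) x y : D0 x -> D0 y -> D0 (c *: x + y).
Proof.
move=> [l ->] [l' ->]; exists ([seq (c *: ba.1, ba.2) | ba <- l] ++ l').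
rewrite big_cat big_map scaler_sumr; congr (_ + _); apply: eq_bigr => ba _.
by have [aL _ _ _] := aP; rewrite (scalable_linear aL) cmulZl.
Qed.

Let D0_mul b x : D0 x -> D0 (a b ** x).
Proof.
move=> [l ->]; exists [seq (b ** ba.1, ba.2) | ba <- l].
rewrite big_map cmul_sumr; apply: eq_bigr => ba _.
by have [_ aM _ _] := aP; rewrite aM cmulA.
Qed.

Let Y_linear (c : R[i]) x y : Y x -> Y y -> Y (c *: x + y).
Proof.
move=> Yx Yy eps eps0; have [d d0 hd] := linear_approx c x y eps0.
have [x' D0x' xx'] := Yx d d0; have [y' D0y' yy'] := Yy d d0.
by exists (c *: x' + y'); [exact: D0_linear | exact: hd].
Qed.

Let Y_mul b x : Y x -> Y (a b ** x).
Proof.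
move=> Yx eps eps0; have [d d0 hd] := cmul_approx (a b) x eps0.
have [x' D0x' xx'] := Yx d d0.
exists (a b ** x'); first exact: D0_mul.
by apply: hd => //; rewrite subrr normr0.
Qed.

Let D0_Y x : D0 x -> Y x.
Proof. by move=> D0x eps eps0; exists x; rewrite ?subrr ?normr0. Qed.

Let Y_0 : Y 0.
Proof. by apply: D0_Y; exists [::]; rewrite big_nil. Qed.

Let Y_sum (I : Type) (r : seq I) (W : pred I) (F : I -> DQ) :
  (forall i, W i -> Y (F i)) -> Y (\sum_(i <- r | W i) F i).
Proof.
move=> h; elim/big_ind : _ => // x y Yx Yy.
by have := Y_linear 1 Yx Yy; rewrite scale1r.
Qed.

Definition spanned b := forall c, Y (t b c).

Let spanned_linear (c : R[i]) b b' :
  spanned b -> spanned b' -> spanned (c *: b + b').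
Proof.
by move=> Wb Wb' x; rewrite (tensDl tP) (tensZl tP); exact: Y_linear.
Qed.

(* Approximating b (x) 1 by sums of a(b_i) (1 (x) c_i) gives
   b b' (x) c ~ \sum_i a(b_i) (b' (x) c_i c), and Y is stable under a(b_i). *)
Let spanned_mul b b' : spanned b -> spanned b' -> spanned (b ** b').
Proof.
move=> Wb Wb' c; have [one1 _] := cqg_oneP c.
rewrite -one1 -(tensM tP); apply: approx_approx => eps eps0.
have [d d0 hd] := cmul_approx (t b one) (t b' c) eps0.
have [_ [l ->] bl] := Wb one d d0.
exists ((\sum_(ba <- l) a ba.1 ** t e ba.2) ** t b' c); last first.
  by apply: hd => //; rewrite subrr normr0.
rewrite cmul_suml; apply: Y_sum => ba _; rewrite -cmulA (tensM tP).
by have [-> _] := eP b'; exact: Y_mul.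
Qed.

(** If [a x_j = \sum_i x_i (x) v_ij], a right inverse of the matrix [v] recovers
    [x_k (x) c = \sum_j a x_j (1 (x) v'_kj c)]. *)
Lemma spanned_of_corep (I : finType) (x : I -> D) (v v' : I -> I -> Q) :
  (forall j, a (x j) = \sum_i t (x i) (v i j)) ->
  (forall i k, \sum_j v i j ** v' k j = if i == k then one else 0) ->
  forall k, spanned (x k).
Proof.
move=> ax vv' k c; apply: D0_Y; exists [seq (x j, v' k j ** c) | j : I].
rewrite big_image /=; under eq_bigr => j _ do rewrite ax cmul_suml.
rewrite exchange_big (bigD1 k)//= [X in _ + X]big1 ?addr0 => [|i ik].
  under eq_bigr => j _ do rewrite (tensM tP) cmulA.
  rewrite -(tens_sumr tP) -cmul_suml vv' eqxx.
  by have [_ ->] := eP (x k); have [-> _] := cqg_oneP c.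
under eq_bigr => j _ do rewrite (tensM tP) cmulA.
by rewrite -(tens_sumr tP) -cmul_suml vv' (negPf ik) cmul0x (tens0r tP).
Qed.

(* iota is b |-> b (x) 1, which is thereby continuous. *)
Variable iota : D -> DQ.
Hypothesis iotaP : star_hom iota.
Hypothesis iotaE : forall b, iota b = t b one.

Let spanned_closed b : approx spanned b -> spanned b.
Proof.
move=> hb c; have [iL _ _ iC] := iotaP.
have [k k0 hk] := continuous_linear_bound iL iC.
apply: approx_approx => eps eps0.
have k1 : 0 < k * (`|t e c| + 1) by rewrite mulr_gt0// ltr_wpDl.
have [b' Wb' bb'] := hb _ (divr_gt0 eps0 k1).
exists (t b' c); first exact: Wb'.
have tE x : t x c = iota x ** t e c.
  rewrite iotaE (tensM tP); have [_ ->] := eP x.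
  by have [-> _] := cqg_oneP c.
rewrite (tE b) (tE b') -cmulBl -(zmod_morphism_linear iL).
rewrite (le_lt_trans (cnormM _ _))//.
apply: (@le_lt_trans _ _ (k * (`|t e c| + 1) * `|b - b'|)); last first.
  by rewrite mulrC -ltr_pdivlMr.
rewrite [leRHS]mulrAC ler_pM// lerDl; exact: ler01.
Qed.

Lemma podles_density (S : set D) : generates S ->
  (forall x, S x -> spanned x /\ spanned (star x)) ->
  dense [set x : DQ | exists n (b : 'I_n -> D) (c : 'I_n -> Q),
                        x = \sum_i a (b i) ** t e (c i)].
Proof.
move=> genS hS.
have spannedT b : spanned b.
  suff : [set b | spanned b /\ spanned (star b)] = setT.
    by move=> h; have : setT b by []; rewrite -h => -[].
  apply: genS => //.
  - apply: approx_closed => {}b hb; split; apply: spanned_closed => eps /hb.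
      by case=> b' [? _]; exists b'.
    case=> b' [_ ?] bb'; exists (star b') => //.
    by rewrite -starB star_norm.
  - move=> c x y [? ?] [? ?]; split; first exact: spanned_linear.
    by rewrite starD starZ; exact: spanned_linear.
  - move=> x y [? ?] [? ?]; split; first exact: spanned_mul.
    by rewrite starM; exact: spanned_mul.
  - by move=> x [? ?]; rewrite /= starK.
apply/denseP => x; have : Y x.
  apply: approx_approx => eps /(tens_dense tP x)[_ [l ->] xl].
  exists (\sum_(ab <- l) t ab.1 ab.2) => //.
  by apply: Y_sum => ab _; exact: spannedT.
move=> Yx eps /Yx[_ [l ->] xl]; exists (\sum_(ba <- l) a ba.1 ** t e ba.2) => //.
exists (size l), (fun i => (nth (0, 0) l i).1), (fun i => (nth (0, 0) l i).2).
by rewrite (big_nth (0, 0)) big_mkord.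
Qed.

End Density.

Lemma cqg_one_star (R : realType) (Q : compact_quantum_group R) :
  star (cqg_one Q) = cqg_one Q.
Proof.
have [h _] := @cqg_oneP _ Q (star (cqg_one Q)).
by rewrite -[RHS]starK -[in RHS]h starM starK h.
Qed.

(** The continuity of [b |-> b (x) 1] comes from the universal property: the
    homomorphism with the prescribed values on the generators coincides with it,
    because the points of agreement form a closed set by [approx_tens_leg]. *)
Lemma graph_cstar_unit_leg (R : realType) (G : multigraph) (D : cstarType R)
    (s : edge G -> D) (p : vert G -> D) (Q : compact_quantum_group R)
    (DQ : min_tensor D Q) : is_graph_cstar s p ->
  exists2 iota : D -> DQ, star_hom iota & forall b, iota b = tens DQ b (cqg_one Q).
Proof.
move=> [ckP gen univ]; have tP := @tensP _ _ _ DQ.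
have [one1 _] := @cqg_oneP _ Q (cqg_one Q).
have tS b : star (tens DQ b (cqg_one Q)) = tens DQ (star b) (cqg_one Q).
  by rewrite (tensS tP) cqg_one_star.
have tM b b' : tens DQ b (cqg_one Q) ** tens DQ b' (cqg_one Q) =
    tens DQ (b ** b') (cqg_one Q) by rewrite (tensM tP) one1.
have ckt : ck_family (fun e => tens DQ (s e) (cqg_one Q))
    (fun v => tens DQ (p v) (cqg_one Q)).
  have [hs hp hpp hss hsum] := ckP; split=> [e|v|v w vw|e|v sv].
  - by rewrite tS !tM hs.
  - by rewrite tS tM; have [-> ->] := hp v.
  - by rewrite tM hpp// (tens0l tP).
  - by rewrite tS tM hss.
  - rewrite -hsum// (tens_suml tP); apply: eq_bigr => e _.
    by rewrite tS tM.
have [iota [iotaP iotas iotap]] := univ _ _ _ ckt; exists iota => // b.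
have [iL iM iS iC] := iotaP.
suff : [set b | iota b = tens DQ b (cqg_one Q)] = setT.
  by move=> h; have : setT b by []; rewrite -h.
apply: gen.
- by apply: approx_closed => {}b hb; exact: approx_tens_leg.
- by move=> _ [[e _ <-]|[v _ <-]].
- by move=> c x y /= hx hy; rewrite iL hx hy (tensDl tP) (tensZl tP).
- by move=> x y /= hx hy; rewrite iM hx hy tM.
- by move=> x /= hx; rewrite iS hx tS.
Qed.

(** * The co-action on the graph algebra *)

Theorem theorem5p2 (R : realType) (G : multigraph) (hG : no_isolated G)
    (Q : compact_quantum_group R)
    (beta : {ffun edge G -> R[i]} -> {ffun edge G -> Q})
    (alpha : {ffun vert G -> R[i]} -> {ffun vert G -> Q})
    (hbeta : banica_coaction beta) (halpha : is_induced beta alpha)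
    (CG : cstarType R) (s : edge G -> CG) (p : vert G -> CG)
    (hCG : is_graph_cstar s p)
    (CGQ : min_tensor CG Q) (CGQQ : min_tensor3 CGQ (cqg_tens Q)) :
  exists beta' : CG -> CGQ,
    [/\ is_coaction CGQQ beta',
        forall i : vert G,
          beta' (p i) = \sum_(k : vert G) tens CGQ (p k) (coef alpha k i)
      & forall tau : edge G,
          beta' (s tau) =
            \sum_(sigma : edge G) tens CGQ (s sigma) (coef beta sigma tau)].
Proof.
have [[[betaL beta_delta] beta_unitary] _ _ _ _] := hbeta.
have [_ [alpha_s [alpha_t [alpha_sP alpha_tP alpha_sE alpha_tE]]]] := halpha.
have [ckP gen univ] := hCG.
have tP := @tensP _ _ _ CGQ.
have lP := @tenslP _ _ _ _ _ _ CGQQ.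
have rP := @tensrP _ _ _ _ _ _ CGQQ.
have eP := ck_is_unit hG ckP gen.
have genE := ck_edges_generate hG ckP gen.
have [beta' [beta'P beta's beta'p]] := univ _ _ _ (coaction_ck_family
  betaL beta_unitary alpha_sP alpha_tP alpha_sE alpha_tE hG ckP CGQ).
exists beta'; split=> //; split=> //.
  have [h1 h1P h1E] := star_hom_tensor tP lP beta'P (star_hom_id Q).
  have [h2 h2P h2E] := star_hom_tensor tP rP (star_hom_id CG) (cqg_delta_hom Q).
  exists h1, h2; split=> //.
  apply: (star_hom_ext genE (star_hom_comp h1P beta'P) (star_hom_comp h2P beta'P)).
  move=> _ [tau _ <-] /=; rewrite beta's !star_hom_sum//.
  under eq_bigr => x _ do rewrite h1E beta's (tens_suml lP).
  rewrite exchange_big; apply: eq_bigr => x _ /=.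
  rewrite h2E beta_delta (tens_sumr rP); apply: eq_bigr => y _.
  exact: tenslr.
exists (ck_unit p); split=> //.
  rewrite star_hom_sum//; under eq_bigr => v _ do rewrite beta'p.
  exact: (coaction_unit betaL beta_unitary alpha_sP alpha_tP alpha_sE alpha_tE hG).
have [iota iotaP iotaE] := graph_cstar_unit_leg CGQ hCG.
apply: (podles_density eP beta'P iotaP iotaE genE) => _ [sigma _ <-].
have [_ _ beta'S _] := beta'P; split.
  exact: (spanned_of_corep eP beta's (unitary_rows beta_unitary)).
apply: (spanned_of_corep (x := fun e => star (s e)) eP _
  (conj_unitary_rows beta_unitary)) => tau.
rewrite beta'S beta's star_sum; apply: eq_bigr => x _.
by rewrite (tensS tP).
Qed.
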